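(* Let $n\ge1$ and $\gamma\in\mathbb{R}$ with $|\gamma|<\sqrt{n/e}$. Let $\mu_L$ be the discrete LQG measure on $\mathbb{T}^n_L$ and $\mu_{L,\sharp}$ the semi-discrete LQG measure on $\mathbb{T}^n$ with parameter $\gamma$. Then $$\sup_L\mathbf E\Big[\big|\mu_L(\mathbb{T}^n_L)\big|^2\Big]<\infty\qquad\text{and}\qquad\sup_L\mathbf E\Big[\big|\mu_{L,\sharp}(\mathbb{T}^n)\big|^2\Big]<\infty,$$ the suprema being over odd positive integers $L$.
   Context: $\mathbb{T}^n=(\mathbb{R}/\mathbb{Z})^n$ with Lebesgue measure $dx$; $L$ is an odd positive integer; $\mathbb{T}^n_L=(\frac1L\mathbb{Z})^n/\mathbb{Z}^n\subset\mathbb{T}^n$; $m_L=L^{-n}\sum_{v\in\mathbb{T}^n_L}\delta_v$; $\mathbb{Z}^n_L=\{z\in\mathbb{Z}^n:\max_k|z_k|<L/2\}$; $a_n=\frac{2}{\Gamma(n/2)(4\pi)^{n/2}}$; $\lambda_{L,z}=4L^2\sum_{k=1}^n\sin^2(\pi z_k/L)$. Fix $\hat{\mathbb{Z}}^n\subset\mathbb{Z}^n\setminus\{0\}$ with $\mathbb{Z}^n\setminus\{0\}=\hat{\mathbb{Z}}^n\,\dot\cup\,(-\hat{\mathbb{Z}}^n)$ and set $\varphi_z(x)=\sqrt2\cos(2\pi z\cdot x)$ for $z\in\hat{\mathbb{Z}}^n$, $\varphi_z(x)=\sqrt2\sin(2\pi z\cdot x)$ for $z\in-\hat{\mathbb{Z}}^n$.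 Let $(\xi_z)_{z\ne0}$ be i.i.d. standard normal variables on $(\Omega,\mathfrak A,\mathbf P)$. For $x,y\in\mathbb{T}^n$ let $h_{L,\sharp}(x)=a_n^{-1/2}\sum_{z\in\mathbb{Z}^n_L\setminus\{0\}}\lambda_{L,z}^{-n/4}\xi_z\varphi_z(x)$, with covariance $k_{L,\sharp}(x,y)=\frac1{a_n}\sum_{z\in\mathbb{Z}^n_L\setminus\{0\}}\lambda_{L,z}^{-n/2}\cos(2\pi z\cdot(x-y))$, and let $h_L$, $k_L$ be the restrictions of $h_{L,\sharp}$, $k_{L,\sharp}$ to $\mathbb{T}^n_L$, $\mathbb{T}^n_L\times\mathbb{T}^n_L$ ($h_L$ is the discrete polyharmonic field, $h_{L,\sharp}$ its Fourier extension). Define $d\mu_L(v)=\exp\big(\gamma h_L(v)-\frac{\gamma^2}2k_L(v,v)\big)dm_L(v)$ on $\mathbb{T}^n_L$ and $d\mu_{L,\sharp}(x)=\exp\big(\gamma h_{L,\sharp}(x)-\frac{\gamma^2}2k_{L,\sharp}(x,x)\big)dx$ on $\mathbb{T}^n$. *)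

(* Defs.v *)
From HB Require Import structures.
From mathcomp Require Import all_boot all_order all_algebra finmap.
From mathcomp Require Import all_classical all_reals all_analysis.

Set Implicit Arguments.
Unset Strict Implicit.
Unset Printing Implicit Defensive.

Import Order.TTheory GRing.Theory Num.Theory.
Import numFieldNormedType.Exports.

Local Open Scope classical_set_scope.
Local Open Scope ring_scope.

Section lebesgue_tuple.
Variable R : realType.

Fixpoint lebesgue_tuple n : set (n.-tuple R) -> \bar R :=
  if n is n'.+1 then
    fun A => (\int[lebesgue_measure]_x
      lebesgue_tuple [set t : n'.-tuple R | A [tuple of (x : R) :: t]])%E
  else \d_[tuple].

Local Notation leb n := (@lebesgue_tuple n).

Section cons.
Variables (n : nat) (mu : {sigma_finite_measure set (n.-tuple R) -> \bar R}).

Let tcons (p : (measurableTypeR R * n.-tuple R)%type) : n.+1.-tuple R :=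
  [tuple of (p.1 : R) :: p.2].

Let tuncons (t : n.+1.-tuple R) : (measurableTypeR R * n.-tuple R)%type :=
  (thead t, [tuple of behead t]).

Let measurable_tcons : measurable_fun setT tcons.
Proof.
apply: (@measurable_cons _ _ (measurableTypeR R * n.-tuple R)%type R fst n snd).
  exact: measurable_fst.
exact: measurable_snd.
Qed.

Let measurable_tuncons : measurable_fun setT tuncons.
Proof.
apply/measurable_fun_pairP; split; last exact: measurable_behead.
exact: (@measurable_tnth _ R n.+1 ord0).
Qed.

Let tconsK : cancel tcons tuncons.
Proof. by move=> [x t]; congr pair; apply: val_inj. Qed.

(* Retyped so that the product below is taken over a sigma-finite measure;
   inference does not find the product's own sigma-finite structure. *)
Let leb1 : {sigma_finite_measure set (measurableTypeR R) -> \bar R} :=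
  @lebesgue_measure R.

Let m : {measure set (measurableTypeR R * n.-tuple R)%type -> \bar R} :=
  (leb1 \x mu)%E.

Let m_sigma_finite : sigma_finite setT m.
Proof.
exact: (isSigmaFinite.sigma_finiteT
  (lebesgue_integral_fubini.measure_function_Measure_isSigmaFinite__to__measure_function_isSigmaFinite
     leb1 mu)).
Qed.

Definition lebesgue_cons : set (n.+1.-tuple R) -> \bar R := pushforward m tcons.

Let lebesgue_cons0 : lebesgue_cons set0 = 0%E.
Proof. by rewrite /lebesgue_cons /pushforward preimage_set0 measure0. Qed.

Let lebesgue_cons_ge0 A : (0 <= lebesgue_cons A)%E.
Proof. exact: measure_ge0. Qed.

Let lebesgue_cons_additive : semi_sigma_additive lebesgue_cons.
Proof.
exact: (@measure_semi_sigma_additive _ _ _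
  (measure_function_pushforward__canonical__measure_function_Measure m
     measurable_tcons)).
Qed.

HB.instance Definition _ := isMeasure.Build _ _ _ lebesgue_cons
  lebesgue_cons0 lebesgue_cons_ge0 lebesgue_cons_additive.

Let lebesgue_cons_sigma_finite : sigma_finite setT lebesgue_cons.
Proof.
have [F FT Foo] := m_sigma_finite.
exists (fun k => tuncons @^-1` F k); first by rewrite -preimage_bigcup -FT.
move=> k; have [mF Fk] := Foo k; split.
  by rewrite -[X in measurable X]setTI; exact: measurable_tuncons.
rewrite /lebesgue_cons /pushforward -comp_preimage (_ : _ \o _ = id)//.
by apply/funext => x /=; rewrite tconsK.
Qed.

HB.instance Definition _ := Measure_isSigmaFinite.Build _ _ _ lebesgue_cons
  lebesgue_cons_sigma_finite.

Lemma lebesgue_consE : leb n = mu -> leb n.+1 = lebesgue_cons.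
Proof.
move=> E; apply/funext => A; apply: eq_integral => x _.
rewrite -[LHS]/(leb n [set t : n.-tuple R | A [tuple of (x : R) :: t]]) E; congr (mu _).
by apply/seteqP; split => t /=; rewrite /xsection/= ?inE.
Qed.

End cons.

Lemma lebesgue_tuple_sigma_finite_measure n :
  exists mu : {sigma_finite_measure set (n.-tuple R) -> \bar R}, leb n = mu.
Proof.
elim: n => [|n [mu /lebesgue_consE E]]; first by exists (\d_[tuple])%R.
by exists (lebesgue_cons mu).
Qed.

Section instances.
Variable n : nat.

Let leb0 : leb n set0 = 0%E.
Proof. by have [mu ->] := lebesgue_tuple_sigma_finite_measure n. Qed.

Let leb_ge0 A : (0 <= leb n A)%E.
Proof. by have [mu ->] := lebesgue_tuple_sigma_finite_measure n. Qed.

Let leb_sigma_additive : semi_sigma_additive (leb n).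
Proof.
have [mu ->] := lebesgue_tuple_sigma_finite_measure n.
exact: measure_semi_sigma_additive.
Qed.

HB.instance Definition _ := isMeasure.Build _ _ _ (leb n)
  leb0 leb_ge0 leb_sigma_additive.

Let leb_sigma_finite : sigma_finite setT (leb n).
Proof.
have [mu ->] := lebesgue_tuple_sigma_finite_measure n.
exact: sigma_finiteT.
Qed.

HB.instance Definition _ := Measure_isSigmaFinite.Build _ _ _ (leb n)
  leb_sigma_finite.

End instances.

End lebesgue_tuple.
Arguments lebesgue_tuple R n : clear implicits.

Section torus.
Variables (R : realType) (n : nat).

(* [torus] and [torus_grid L] are the fundamental domains [0, 1)^n of R^n / Z^n
   and of ((1/L)Z)^n / Z^n; all functions integrated below are Z^n-periodic. *)
Definition torus : set (n.-tuple R) :=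
  [set x | forall k, 0 <= tnth x k < 1].

Definition torus_grid (L : nat) : set (n.-tuple R) :=
  [set v | torus v /\
    forall k, exists j : int, tnth v k = j%:~R / L%:R].

Lemma finite_torus_grid L : finite_set (torus_grid L).
Proof.
pose f (j : {ffun 'I_n -> 'I_L.+1}) : n.-tuple R :=
  [tuple (j k)%:R / L%:R | k < n].
apply: (@sub_finite_set _ _ (range f)); last first.
  exact: finite_image.
move=> v [v01 vj].
have {}vj k : exists j : 'I_L.+1, tnth v k = j%:R / L%:R.
  have [[j|j] vE] := vj k.
    case: (posnP L) => [L0|L0].
      by exists ord0; rewrite vE L0 invr0 !mulr0.
    have jL : (j < L.+1)%N.
      have /andP[_] := v01 k; rewrite vE ltr_pdivrMr ?ltr0n// mul1r ltr_nat.
      exact: ltnW.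
    by exists (Ordinal jL).
  have /andP[v0 _] := v01 k; exists ord0; rewrite mul0r; apply/eqP.
  rewrite eq_le v0 andbT vE mulr_le0_ge0 ?invr_ge0//.
exists [ffun k => projT1 (cid (vj k))] => //.
apply: eq_from_tnth => k; rewrite tnth_mktuple ffunE.
by case: cid.
Qed.

Definition grid_measure (L : nat) (A : set (n.-tuple R)) : \bar R :=
  ((L%:R ^- n)%:E * \sum_(v \in torus_grid L) (\d_v A : \bar R))%E.

Section grid_measure.
Variable L : nat.

Let s := fset_set (torus_grid L).
Let x0 : n.-tuple R := [tuple of nseq n 0].
Let c0 : 0 <= (L%:R : R) ^- n.
Proof. by rewrite invr_ge0 exprn_ge0. Qed.

Let m : {measure set (n.-tuple R) -> \bar R} :=
  mscale (NngNum c0) (msum (fun i => dirac (nth x0 s i)) (size s)).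

Let grid_measureE : grid_measure L = m.
Proof.
apply/funext => A; rewrite /m /= /mscale /=; congr (_ * _)%E.
rewrite fsbig_finite/=; last exact: finite_torus_grid.
by rewrite (big_nth x0) big_mkord.
Qed.

Let grid0 : grid_measure L set0 = 0%E.
Proof. by rewrite grid_measureE. Qed.

Let grid_ge0 A : (0 <= grid_measure L A)%E.
Proof. by rewrite grid_measureE. Qed.

Let grid_sigma_additive : semi_sigma_additive (grid_measure L).
Proof. by rewrite grid_measureE; exact: measure_semi_sigma_additive. Qed.

HB.instance Definition _ := isMeasure.Build _ _ _ (grid_measure L)
  grid0 grid_ge0 grid_sigma_additive.

End grid_measure.

End torus.
Arguments torus R n : clear implicits.
Arguments torus_grid R n L : clear implicits.
Arguments grid_measure R n L : clear implicits.

Section fields.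
Variables (R : realType) (n : nat).
Implicit Types (x y : n.-tuple R) (z : 'rV[int]_n).

(* max_k |z_k| < L / 2, with denominators cleared *)
Definition intbox (L : nat) : set 'rV[int]_n :=
  [set z | (2 * \max_(k < n) `|z 0%R k| < L)%N].

Lemma finite_intbox L : finite_set (intbox L).
Proof.
pose f (j : {ffun 'I_n -> 'I_L.+1 * bool}) : 'rV[int]_n :=
  \row_k ((-1) ^+ (j k).2 * ((j k).1 : nat)%:Z).
apply: (@sub_finite_set _ _ (range f)); last exact: finite_image.
move=> z zL.
have zkL k : (`|z 0%R k| < L.+1)%N.
  have zk : (`|z 0%R k| <= \max_(i < n) `|z 0%R i|)%N.
    exact: (@leq_bigmax _ (fun i => `|z 0%R i|%N)).
  rewrite ltnS; apply: (leq_trans zk); apply: ltnW.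
  by apply: leq_ltn_trans zL; rewrite leq_pmull.
exists [ffun k => (Ordinal (zkL k), z 0 k < 0)] => //.
by apply/rowP => k; rewrite mxE ffunE /= -intEsign.
Qed.

Definition zdot z (u : 'I_n -> R) : R := \sum_(k < n) (z 0 k)%:~R * u k.

Definition Gamma (s : R) : R :=
  Rintegral lebesgue_measure `]0, +oo[ (fun t => t `^ (s - 1) * expR (- t)).

Definition a_const : R :=
  2 / (Gamma (n%:R / 2) * (4 * pi) `^ (n%:R / 2)).

Definition lambda (L : nat) z : R :=
  4 * L%:R ^+ 2 * \sum_(k < n) sin (pi * (z 0 k)%:~R / L%:R) ^+ 2.

Definition half_lattice (Zhat : set 'rV[int]_n) :=
  ~` [set 0] = Zhat `|` -%R @` Zhat /\ Zhat `&` -%R @` Zhat = set0.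

Definition phi (Zhat : set 'rV[int]_n) z x : R :=
  if z \in Zhat then Num.sqrt 2 * cos (2 * pi * zdot z (tnth x))
  else Num.sqrt 2 * sin (2 * pi * zdot z (tnth x)).

Definition fourier_field (Zhat : set 'rV[int]_n) (L : nat) (xi : 'rV[int]_n -> R) x : R :=
  a_const `^ (- 2^-1) *
  \sum_(z \in intbox L `\ 0)
    lambda L z `^ (- (n%:R / 4)) * xi z * phi Zhat z x.

Definition fourier_cov (L : nat) x y : R :=
  a_const^-1 *
  \sum_(z \in intbox L `\ 0)
    lambda L z `^ (- (n%:R / 2)) *
    cos (2 * pi * zdot z (fun k => tnth x k - tnth y k)).

Definition lqg (m : set (n.-tuple R) -> \bar R) (gamma : R)
    (h : n.-tuple R -> R) (k : n.-tuple R -> n.-tuple R -> R)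
    (A : set (n.-tuple R)) : \bar R :=
  (\int[m]_(x in A) (expR (gamma * h x - gamma ^+ 2 / 2 * k x x))%:E)%E.

Definition lqg_discrete Zhat (gamma : R) (L : nat) (xi : 'rV[int]_n -> R) :=
  lqg (grid_measure R n L) gamma (fourier_field Zhat L xi) (fourier_cov L).

Definition lqg_semidiscrete Zhat (gamma : R) (L : nat) (xi : 'rV[int]_n -> R) :=
  lqg (lebesgue_tuple R n) gamma (fourier_field Zhat L xi) (fourier_cov L).

End fields.
Arguments intbox n L : clear implicits.
Arguments a_const R n : clear implicits.

Definition mutually_independent d (T : measurableType d) (R : realType)
    (P : probability T R) (I : choiceType) (D : set I) (X : I -> T -> R) :=
  forall (J : {fset I}) (B : I -> set R), [set` J] `<=` D ->
    (forall i, measurable (B i)) ->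
    P (\bigcap_(i in [set` J]) X i @^-1` B i) =
    (\prod_(i <- J) P (X i @^-1` B i))%E.

Definition iid_standard_normal d (T : measurableType d) (R : realType)
    (P : probability T R) (I : choiceType) (D : set I) (X : I -> {RV P >-> R}) :=
  (forall i, D i -> forall B : set R, measurable B ->
     distribution P (X i) B = normal_prob 0 1 B) /\
  mutually_independent P D (fun i => X i : T -> R).
Arguments iid_standard_normal {d T R} P {I} D X.

(* Main.v *)
(* Expanding the square and using the moment generating function of a Gaussian
   vector, E |mu(A)|^2 is the double integral of exp(gamma^2 k_L(x, y)).  Since
   exp u <= 2 cosh u, only the even moments of y |-> k_L(x, y) matter.  For even
   j, expanding k_L^j and integrating leaves the j-tuples of frequencies whose
   sum vanishes (modulo L on the grid); any j - 1 of the frequencies determine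
   the last one, so AM-GM bounds the moment by (sum_z f_z^(j/(j-1)))^(j-1),
   where f_z are the Fourier coefficients of k_L.  The inner sum runs over
   lambda_z^(-s) with s = (n/2) j/(j-1), and the Gamma integral representation
   of |z|^(-2s) together with theta-function bounds shows that it is at most
   r (j-1)/n + O(1) for every r > 1: the constant a_n is exactly the one giving
   slope 1/n.  As j! >= (j/e)^j, the series of moments is dominated by a
   geometric one of ratio about e gamma^2 / n, which is < 1. *)
From HB Require Import structures.
Require Import Defs.
From mathcomp Require Import all_boot all_order all_algebra finmap.
From mathcomp Require Import all_classical all_reals all_analysis.
From mathcomp Require Import measurable_realfun complex zify ring lra.

Set Implicit Arguments.
Unset Strict Implicit.
Unset Printing Implicit Defensive.

Import Order.TTheory GRing.Theory Num.Theory.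
Import numFieldNormedType.Exports.
Local Open Scope classical_set_scope.
Local Open Scope ring_scope.

(** * Exponential moments of independent Gaussian variables *)

(** Both measures go through one argument. Of a measure [m] and a domain [A] the moment bounds use
    that [m A = 1] and that the integral of 1 + cos(2 pi z.y + c) over [A] is 1 whenever L does not
    divide all coordinates of z. Stating orthogonality for 1 + cos instead of cos, and keeping only
    even powers of the kernel, makes every integrand nonnegative, so Tonelli and monotone
    convergence apply directly. The bound on the inner integral is uniform in x, so the outer
    integral over a set of mass 1 costs nothing. The AM-GM step plays the role of the
    Hausdorff-Young inequality. Bounding the kernel by the sum of its coefficients would fail, since
    that sum grows like log L; the exponent j/(j-1) > 1 makes the sum bounded in L, at the price of
    a pole of size proportional to j. Oddness of L enters through the frequency box: for L = 2M+1 it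
    is the cube [-M, M]^n, which is symmetric under z -> -z and whose points are pairwise
    incongruent modulo L. *)

Section weighted.
Context {d1 d2} {X : measurableType d1} {Y : measurableType d2} {R : realType}.
Variables (mu : {measure set X -> \bar R}) (nu : {measure set Y -> \bar R}).
Variables (w : X -> R) (phi : X -> Y) (c : R).
Hypothesis mw : measurable_fun setT w.
Hypothesis w0 : forall x, 0 <= w x.
Hypothesis mphi : measurable_fun setT phi.
Hypothesis wE : forall B, measurable B ->
  (\int[mu]_x (w x * \1_B (phi x))%:E = c%:E * nu B)%E.

Import HBNNSimple.

Let weighted_nnsfun (g : {nnsfun Y >-> R}) :
  (\int[mu]_x (w x * g (phi x))%:E = c%:E * \int[nu]_y (g y)%:E)%E.
Proof.
have mind (r : R) : measurable_fun setT (fun x => w x * \1_(g @^-1` [set r]) (phi x)).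
  apply: measurable_funM => //.
  by apply: measurableT_comp => //; exact: measurable_indic.
transitivity (\int[mu]_x (\sum_(r \in range g)
    (r%:E * (w x * \1_(g @^-1` [set r]) (phi x))%:E)))%E.
  apply: eq_integral => x _; rewrite fimfunE.
  rewrite !fsbig_finite//=; do ?exact: fimfunP.
  under [RHS]eq_bigr do rewrite -EFinM.
  by rewrite sumEFin mulr_sumr; congr EFin; apply: eq_bigr => r _; rewrite mulrCA.
rewrite ge0_integral_fsum//; last 2 first.
- move=> r; apply: measurable_funeM; exact/measurable_EFinP.
- move=> r x _; rewrite -EFinM lee_fin mulrCA mulr_ge0//.
  have [[y _ <-]|nr] := pselect (range g r); first by rewrite mulr_ge0.
  rewrite indicE memNset ?mulr0//= => gr; apply: nr; by exists (phi x).
transitivity (\sum_(r \in range g) r%:E * (c%:E * nu (g @^-1` [set r])))%E.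
  apply: eq_fsbigr => r /[!inE] -[y _ gr].
  rewrite ge0_integralZl_EFin//; last 3 first.
  - by move=> x _; rewrite lee_fin mulr_ge0.
  - exact/measurable_EFinP.
  - by rewrite -gr.
  by rewrite wE.
rewrite integralT_nnsfun sintegralE !fsbig_finite//=; do ?exact: fimfunP.
rewrite ge0_sume_distrr//; first by apply: eq_bigr => r _; rewrite muleCA.
move=> r _; exact: nnsfun_mulemu_ge0.
Qed.

(** Both sides are additive and continuous along increasing sequences in [g], so the identity for
    indicators extends through simple functions. It serves as change of density ([phi] the
    identity), as change of law ([w] constant), and as factorisation under independence ([w] the
    remaining factors). *)
Lemma ge0_integral_weighted (g : Y -> R) : measurable_fun setT g ->
  (forall y, 0 <= g y) ->
  (\int[mu]_x (w x * g (phi x))%:E = c%:E * \int[nu]_y (g y)%:E)%E.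
Proof.
move=> mg g0.
have mEg : measurable_fun [set: Y] (EFin \o g) by exact/measurable_EFinP.
pose f := nnsfun_approx measurableT mEg.
have fg y : (f n y)%:E @[n --> \oo] --> (g y)%:E.
  by apply: cvg_nnsfun_approx => //= z _; rewrite lee_fin.
have fnd y : {homo (fun n => f n y) : m n / (m <= n)%N >-> m <= n}.
  by move=> m n mn; exact/lefP/nd_nnsfun_approx.
transitivity (limn (fun n => \int[mu]_x (w x * f n (phi x))%:E))%E.
  rewrite -monotone_convergence//; last 3 first.
  - move=> n; apply/measurable_EFinP/measurable_funM => //.
    by apply: measurableT_comp.
  - by move=> n x _; rewrite lee_fin mulr_ge0.
  - by move=> x _ m n mn; rewrite lee_fin ler_wpM2l// fnd.
  apply: eq_integral => x _; apply/esym/cvg_lim => //.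
  rewrite EFinM; under eq_fun do rewrite EFinM.
  by apply: cvgeZl => //; exact: fg.
transitivity (limn (fun n => c%:E * \int[nu]_y (f n y)%:E))%E.
  by congr (limn _); apply/funext => n; exact: weighted_nnsfun.
rewrite limeMl//; last first.
  apply: ereal_nondecreasing_is_cvgn => a b ab.
  apply: ge0_le_integral => //=.
  - by move=> y _; rewrite lee_fin.
  - exact/measurable_EFinP.
  - exact/measurable_EFinP.
  - by move=> y _; rewrite lee_fin fnd.
rewrite -monotone_convergence//.
- by congr (_ * _)%E; apply: eq_integral => y _; apply/cvg_lim => //; exact: fg.
- by move=> n; exact/measurable_EFinP.
- by move=> n y _; rewrite lee_fin.
- by move=> y _ m n mn; rewrite lee_fin fnd.
Qed.

End weighted.

Section gaussian.
Context {d} {T : measurableType d} {R : realType} (P : probability T R).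

Lemma independent_prod_expectation {I : choiceType} (D : set I) (X : I -> {RV P >-> R})
    (g : I -> R -> R) (e : I -> R) (s : seq I) :
  mutually_independent P D (fun i => X i : T -> R) ->
  uniq s -> (forall i, i \in s -> D i) ->
  (forall i, measurable_fun setT (g i)) -> (forall i x, 0 <= g i x) ->
  (forall i, i \in s -> \int[P]_w (g i (X i w))%:E = (e i)%:E)%E ->
  (\int[P]_w (\prod_(i <- s) g i (X i w))%:E = (\prod_(i <- s) e i)%:E)%E.
Proof.
move=> indX us sD mg g0 ge.
(* The indicators over [t] make the induction on [s] go through: the expectation
   of a product times an indicator of [X i] is the weighted law of [X i]. *)
suff H t (B : I -> set R) : (forall i, measurable (B i)) -> uniq (s ++ t) ->
    (forall i, i \in t -> D i) ->
    (\int[P]_w (\prod_(i <- s) g i (X i w) * \prod_(i <- t) \1_(B i) (X i w))%:E =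
     (\prod_(i <- s) e i * \prod_(i <- t) fine (P (X i @^-1` B i)))%:E)%E.
  have := H [::] (fun=> setT); rewrite cats0 !big_nil mulr1 => <- //.
  by apply: eq_integral => w _; rewrite big_nil mulr1.
have mX i (A : set R) : measurable A -> measurable (X i @^-1` A).
  by move=> mA; rewrite -[X in measurable X]setTI; exact: measurable_funP.
elim: s us sD ge t B => [|i s IH] /= us sD ge t B mB ust tD.
  rewrite big_nil mul1r.
  under eq_integral do rewrite big_nil mul1r.
  transitivity (\int[P]_w (\1_(\bigcap_(i in [set` [fset i in t]%fset]) X i @^-1` B i) w)%:E)%E.
    apply: eq_integral => w _; congr EFin; rewrite indicE.
    have [tw|/existsNP[i /not_implyP[it iw]]] := pselect (forall i, i \in t -> B i (X i w)).
      rewrite big_seq big1 => [|i it]; last by rewrite indicE mem_set//; exact: tw.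
      by rewrite mem_set// => i /=; rewrite !inE; exact: tw.
    rewrite memNset; last by move=> /(_ i) /=; rewrite !inE => /(_ it).
    by apply/eqP; rewrite prodf_seq_eq0; apply/hasP; exists i => //=; rewrite indicE memNset.
  rewrite integral_indic//; last first.
    by apply: fin_bigcap_measurable => // i _; exact: mX.
  rewrite setIT.
  etransitivity.
    by apply: (indX [fset i in t]%fset B) => // i /=; rewrite !inE; exact: tD.
  transitivity (\prod_(i <- t) P (X i @^-1` B i))%E.
    by apply: perm_big; apply: uniq_perm => //= j; rewrite !inE.
  rewrite -prodEFin; apply: eq_bigr => i _; rewrite fineK//.
  by rewrite fin_num_measure//; exact: mX.
have /andP[/= ist usst] := ust; have /andP[/= is_ us_] := us.
have ist' : i \notin t by move: ist; rewrite mem_cat negb_or => /andP[].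
have [sD' ge'] : (forall j, j \in s -> D j) /\
    (forall j, j \in s -> \int[P]_w (g j (X j w))%:E = (e j)%:E)%E.
  by split => j js; [apply: sD|apply: ge]; rewrite inE js orbT.
pose W w := \prod_(i <- s) g i (X i w) * \prod_(i <- t) \1_(B i) (X i w).
have mI j : measurable_fun setT (fun w => \1_(B j) (X j w) : R).
  by apply: (@measurableT_comp _ _ _ _ _ _ (\1_(B j) : R -> R)) => //; exact: measurable_indic.
transitivity (\int[P]_w (W w * g i (X i w))%:E)%E.
  by apply: eq_integral => w _; rewrite /W big_cons; congr EFin; ring.
rewrite (@ge0_integral_weighted _ _ _ _ _ P (distribution P (X i)) W (X i)
   (\prod_(i <- s) e i * \prod_(i <- t) fine (P (X i @^-1` B i)))) //=.
- rewrite ge0_integral_distribution//=; last 2 first.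
  + exact/measurable_EFinP.
  + by move=> y; rewrite lee_fin.
  rewrite ge ?mem_head// -EFinM big_cons; congr EFin; ring.
- apply: measurable_funM.
    by apply: measurable_prod => j _; apply: measurableT_comp.
  by apply: measurable_prod => j _.
- by move=> w; rewrite mulr_ge0// prodr_ge0.
move=> A mA.
(* The factor at [i] moves into the list of indicators. As [i] is not in [t], overriding the set at
   [i] leaves the other indicators unchanged. *)
pose B' j := if j == i then A else B j.
have BB' (F : (I -> set R) -> I -> R) : (forall j, j != i -> F B' j = F B j) ->
    \prod_(j <- t) F B' j = \prod_(j <- t) F B j.
  move=> FF; apply: eq_big_seq => j jt; apply: FF.
  by apply: contraNneq ist' => <-.
have mB' j : measurable (B' j) by rewrite /B'; case: ifP.
have := IH us_ sD' ge' (i :: t) B' mB'.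
have -> : uniq (s ++ i :: t).
  by rewrite uniq_catC /= mem_cat orbC -mem_cat ist uniq_catC.
move=> /(_ erefl) H.
transitivity (\int[P]_w (\prod_(j <- s) g j (X j w) *
       \prod_(j <- i :: t) \1_(B' j) (X j w))%:E)%E.
  apply: eq_integral => w _; rewrite /W big_cons.
  rewrite (BB' (fun B j => \1_(B j) (X j w))) => [|j ji].
    by rewrite /B' eqxx; congr EFin; ring.
  by rewrite /B' (negbTE ji).
rewrite H => [|j]; last by rewrite inE => /predU1P[->|/tD//]; apply: sD; rewrite mem_head.
rewrite big_cons (BB' (fun B j => fine (P (X j @^-1` B j)))) => [|j ji].
  rewrite /B' eqxx mulrCA mulrC EFinM fineK//.
  by rewrite fin_num_measure//; exact: mX.
by rewrite /B' (negbTE ji).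
Qed.

(** Completing the square turns the centred density times exp(c x) into exp(c^2 / 2) times the
    density with mean c. *)
Lemma normal_mgf (c : R) :
  (\int[normal_prob 0 1]_x (expR (c * x))%:E = (expR (c ^+ 2 / 2))%:E)%E.
Proof.
have m1 : measurable_fun setT (fun x : R => expR (c * x)).
  by apply: measurableT_comp => //; exact: measurable_funM.
have -> : (\int[normal_prob 0 1]_x (expR (c * x))%:E =
   \int[lebesgue_measure]_x (normal_pdf 0 1 x * expR (c * x))%:E)%E.
  rewrite (@ge0_integral_weighted _ _ _ _ _ lebesgue_measure (normal_prob 0 1)
    (normal_pdf 0 1) idfun 1 _ _ _ _ (fun x => expR (c * x)))//=.
  - by rewrite mul1e.
  - exact: measurable_normal_pdf.
  - exact: normal_pdf_ge0.
  - exact: measurable_id.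
  move=> B mB; rewrite mul1e /normal_prob [RHS]integral_mkcond.
  apply: eq_integral => x _; rewrite /patch indicE.
  by case: ifPn; rewrite ?mulr1 ?mulr0.
have pdfE x : normal_pdf 0 1 x * expR (c * x) = expR (c ^+ 2 / 2) * normal_pdf c 1 x.
  rewrite !normal_pdfE ?oner_eq0//= /normal_fun.
  by rewrite -mulrA -expRD [RHS]mulrCA -expRD; congr (_ * expR _); field.
under eq_integral do rewrite pdfE EFinM.
rewrite ge0_integralZl//=; last 2 first.
- by apply/measurable_EFinP; exact: measurable_normal_pdf.
- by move=> x _; rewrite lee_fin normal_pdf_ge0.
by rewrite integral_normal_pdf mule1.
Qed.

Lemma iid_normal_mgf {I : choiceType} (D : set I) (X : I -> {RV P >-> R})
    (c : I -> R) (s : seq I) :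
  iid_standard_normal P D X -> uniq s -> (forall i, i \in s -> D i) ->
  (\int[P]_w (expR (\sum_(i <- s) c i * X i w))%:E =
   (expR ((\sum_(i <- s) c i ^+ 2) / 2))%:E)%E.
Proof.
move=> [nX indX] us sD.
under eq_integral do rewrite expR_sum.
rewrite (independent_prod_expectation (D := D) (X := X) (g := fun i x => expR (c i * x))
   (e := fun i => expR (c i ^+ 2 / 2)))//.
- by rewrite mulr_suml expR_sum.
- by move=> i; apply: measurableT_comp => //; exact: measurable_funM.
move=> i /sD Di; rewrite -normal_mgf.
have mXi : measurable_fun setT (X i : T -> R) by exact: measurable_funP.
under eq_integral do rewrite -[expR _]mul1r.
rewrite (@ge0_integral_weighted _ _ _ _ _ P (normal_prob 0 1) (fun=> 1) (X i) 1
  _ _ _ _ (fun x => expR (c i * x)))//=.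
- by rewrite mul1e.
- by move=> B mB; rewrite mul1e -(nX i Di B mB); under eq_integral do rewrite mul1r;
    rewrite integral_indic ?setIT// -[X in measurable X]setTI; exact: measurable_funP.
- by apply: measurableT_comp => //; exact: measurable_funM.
Qed.

End gaussian.

(** * Vanishing of oscillating integrals on the torus and on the grid *)

Section oscillation.
Context {R : realType}.

Lemma cosD2pi_int (x : R) (k : int) : cos (x + 2 * pi * k%:~R) = cos x.
Proof.
have nat_case (m : nat) (y : R) : cos (y + 2 * pi * m%:R) = cos y.
  rewrite -[RHS](periodicn (@cosD2pi R) m); congr cos; congr (_ + _).
  by rewrite mulr_natr (mulrC 2) mulr_natr.
case: k => m; first by rewrite -pmulrn nat_case.
rewrite NegzE mulrNz -pmulrn -[LHS](nat_case m.+1); congr cos; ring.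
Qed.

Lemma measurable_zdot n (z : 'rV[int]_n) (u : 'I_n -> n.-tuple R -> R) D :
  (forall k, measurable_fun D (u k)) ->
  measurable_fun D (fun x => zdot z (fun k => u k x)).
Proof.
move=> mu; rewrite /zdot; apply: measurable_sum => k.
exact: measurable_funM.
Qed.

Lemma measurable_zdot_tnth n (z : 'rV[int]_n) :
  measurable_fun setT (fun x : n.-tuple R => zdot z (tnth x)).
Proof. by apply: (@measurable_zdot n z (fun k x => tnth x k)) => k; exact: measurable_tnth. Qed.

Lemma measurable_cos : measurable_fun setT (@cos R).
Proof. by apply: continuous_measurable_fun; exact: continuous_cos. Qed.

Lemma measurable_sin : measurable_fun setT (@sin R).
Proof. by apply: continuous_measurable_fun; exact: continuous_sin. Qed.

Lemma measurable_fun_torus_osc n (z : 'rV[int]_n) (c : R) D :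
  measurable_fun D (fun x : n.-tuple R => (1 + cos (2 * pi * zdot z (tnth x) + c))%:E).
Proof.
apply: measurable_funTS; apply/measurable_EFinP; apply: measurable_funD => //.
apply: (measurableT_comp measurable_cos); apply: measurable_funD => //.
by apply: measurable_funM => //; exact: measurable_zdot_tnth.
Qed.

Lemma osc_ge0 (t : R) : 0 <= 1 + cos t.
Proof. by have := cos_geN1 t; lra. Qed.

(** The recursion defining [lebesgue_tuple] speaks of sets only. Recognising the measure as the
    image of a product measure under consing gives, by Tonelli, the same recursion for functions. *)
Lemma ge0_integral_lebesgue_tupleS n (f : n.+1.-tuple R -> \bar R) :
  measurable_fun setT f -> (forall x, (0 <= f x)%E) ->
  (\int[lebesgue_tuple R n.+1]_x f x =
   \int[lebesgue_measure]_x0 \int[lebesgue_tuple R n]_t f [tuple of x0 :: t])%E.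
Proof.
move=> mf f0.
pose leb1 : {sigma_finite_measure set (measurableTypeR R) -> \bar R} :=
  @lebesgue_measure R.
pose mu : {sigma_finite_measure set (n.-tuple R) -> \bar R} := lebesgue_tuple R n.
pose tcons (p : (measurableTypeR R * n.-tuple R)%type) : n.+1.-tuple R :=
  [tuple of (p.1 : R) :: p.2].
have mtcons : measurable_fun setT tcons.
  apply: (@measurable_cons _ _ (measurableTypeR R * n.-tuple R)%type R fst n snd).
    exact: measurable_fst.
  exact: measurable_snd.
rewrite (@eq_measure_integral _ _ _ _ (pushforward (leb1 \x mu)%E tcons)); last first.
  by move=> A mA _; exact: (congr1 (fun h => h A) (@lebesgue_consE R n mu erefl)).
rewrite ge0_integral_pushforward//.
rewrite preimage_setT (fubini_tonelli1 (f \o tcons))//.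
- exact: measurableT_comp.
- by move=> x; exact: f0.
Qed.

Lemma measurable_torus n : measurable (torus R n).
Proof.
rewrite (_ : torus R n =
    \bigcap_(k in [set: 'I_n]) ((fun x : n.-tuple R => tnth x k) @^-1` `[0, 1[%classic)).
  apply: fin_bigcap_measurable => // k _.
  rewrite -[X in measurable X]setTI; exact: measurable_tnth.
apply/seteqP; split => x /= tx k; first by move=> _ /=; rewrite in_itv/=; exact: tx.
by have := tx k Logic.I; rewrite /= in_itv.
Qed.

Lemma torus_cons n (x : R) (t : n.-tuple R) :
  (([tuple of x :: t] : n.+1.-tuple R) \in torus R n.+1) =
  (x \in `[0, 1[) && (t \in torus R n).
Proof.
apply/idP/andP => [/set_mem H|[]]; last first.
  rewrite in_itv /= => x01 /set_mem tT; apply/mem_set => k; rewrite (tnth_nth 0) /=.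
  case: k => -[|k] //= kn; by have := tT (Ordinal (kn : (k < n)%N)); rewrite (tnth_nth 0).
split; first by have := H ord0; rewrite (tnth_nth 0) in_itv.
apply/mem_set => k; have := H (lift ord0 k).
by rewrite !(tnth_nth 0).
Qed.

Lemma integral_osc_itv (k : int) (c : R) : k != 0 ->
  (\int[lebesgue_measure]_(x in `[0%R, 1%R[) (1 + cos (2 * pi * (k%:~R * x) + c))%:E = 1)%E.
Proof.
move=> k0; set f := fun x : R => 1 + cos (2 * pi * (k%:~R * x) + c).
have cf : continuous f.
  move=> x; apply: cvgD; first exact: cvg_cst.
  apply: (@cvg_comp _ _ _ (fun x : R => 2 * pi * (k%:~R * x) + c) cos _
    (nbhs (2 * pi * (k%:~R * x) + c))); last exact: continuous_cos.
  by apply: cvgD; [apply: cvgMr; apply: cvgMr; exact: cvg_id|exact: cvg_cst].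
rewrite integral_itv_bndo_bndc; last first.
  by apply/measurable_EFinP; apply: measurable_funTS; exact: continuous_measurable_fun.
pose a : R := 2 * pi * k%:~R.
have a0 : a != 0 by rewrite !mulf_neq0// ?intr_eq0// gt_eqF ?pi_gt0.
pose F (x : R) : R := x + a^-1 * sin (a * x + c).
have dF (x : R) : is_derive x 1 F (f x).
  rewrite /F /f; apply: is_derive_eq.
  rewrite addr0 -[a%:A]/(a * 1) mulr1 -[_ *: _]/(_ * _) (mulrC (cos _)) mulKf//.
  by congr (_ + cos _); rewrite /a; ring.
have cF : continuous F.
  move=> x; apply: differentiable_continuous; apply/derivable1_diffP.
  by have [] := dF x.
rewrite (@continuous_FTC2 _ f F)//.
- rewrite /F mulr0 mulr1 !add0r /a [_ + c]addrC -EFinB; congr EFin.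
  have -> : sin (c + 2 * pi * k%:~R) = sin c.
    rewrite -!cosBpihalf (_ : _ - _ = c - pi / 2 + 2 * pi * k%:~R); last by ring.
    exact: cosD2pi_int.
  by ring.
- exact: continuous_subspaceT.
- split; [by move=> x _; have [] := dF x| |].
    by apply: cvg_at_right_filter; exact: cF.
  by apply: cvg_at_left_filter; exact: cF.
- by move=> x _; rewrite derive1E; apply: derive_val.
Qed.

(** Induction on [n] with a free phase: once the first coordinate is frozen, its contribution to the
    argument of the cosine is absorbed into the phase of the remaining coordinates. *)
Lemma integral_torus_osc n (z : 'rV[int]_n) (c : R) :
  (\int[lebesgue_tuple R n]_(x in torus R n) (1 + cos (2 * pi * zdot z (tnth x) + c))%:E =
   (if z == 0 then 1 + cos c else 1)%:E)%E.
Proof.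
elim: n z c => [|n IH] z c.
  have -> : z = 0 by apply/rowP => -[].
  rewrite eqxx -[lebesgue_tuple R 0]/(\d_([tuple] : 0.-tuple R)).
  rewrite integral_dirac; [|exact: measurable_torus|exact: measurable_fun_torus_osc].
  rewrite diracE mem_set ?mul1e; last by case.
  by rewrite /zdot big_ord0 mulr0 add0r.
have osc0 m (z' : 'rV[int]_m) c' (x : m.-tuple R) :
    (0 <= ((fun x => (1 + cos (2 * pi * zdot z' (tnth x) + c'))%:E) \_ (torus R m)) x)%E.
  by rewrite /patch; case: ifP => // _; rewrite lee_fin osc_ge0.
rewrite integral_mkcond ge0_integral_lebesgue_tupleS; last 2 first.
- apply: (measurable_restrictT _ _).1; first exact: measurable_torus.
  exact: measurable_fun_torus_osc.
- exact: osc0.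
pose z' : 'rV[int]_n := \row_k z 0 (lift ord0 k).
have zE x0 (t : n.-tuple R) :
   zdot z (tnth [tuple of x0 :: t]) = (z 0 ord0)%:~R * x0 + zdot z' (tnth t).
  rewrite /zdot big_ord_recl; congr (_ + _); apply: eq_bigr => k _.
  by rewrite mxE !(tnth_nth 0).
transitivity (\int[lebesgue_measure]_(x0 in `[0%R, 1%R[)
    (if z' == 0 then 1 + cos (2 * pi * ((z 0 ord0)%:~R * x0) + c) else 1)%:E)%E.
  rewrite [RHS]integral_mkcond; apply: eq_integral => x0 _.
  rewrite {2}/patch mem_setE.
  case: ifPn => x01; last first.
    by apply: integral0_eq => t _; rewrite /patch torus_cons (negbTE x01).
  rewrite -(IH z') [RHS]integral_mkcond; apply: eq_integral => t _.
  rewrite /patch torus_cons x01 /=; case: ifP => // _.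
  by congr EFin; congr (_ + cos _); rewrite zE; ring.
have z0E : (z == 0) = (z 0 ord0 == 0) && (z' == 0).
  apply/eqP/andP => [z0|[/eqP z0 /eqP/rowP z'0]].
    by split; [rewrite z0 mxE|apply/eqP/rowP => k; rewrite /z' z0 !mxE].
  apply/rowP => k; rewrite mxE; case: (unliftP ord0 k) => [k' ->|->//].
  by have := z'0 k'; rewrite !mxE.
have L1 (r : R) : (\int[lebesgue_measure]_(x0 in `[0%R, 1%R[) r%:E = r%:E)%E.
  by rewrite integral_cst//= lebesgue_measure_itv/= lte01 oppr0 adde0 mule1.
rewrite z0E; have [z'0|z'0] := eqVneq z' 0; last by rewrite andbF.
have [z0|z0] /= := eqVneq (z 0 ord0) 0; last exact: integral_osc_itv.
under eq_integral do rewrite z0 mul0r mulr0 add0r.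
exact: L1.
Qed.

Lemma lebesgue_tuple_torus n : lebesgue_tuple R n (torus R n) = 1%E.
Proof.
(* At frequency 0 and phase pi / 2 the integrand is constantly 1, so the oscillating integral is the
   volume. *)
have := integral_torus_osc (0 : 'rV[int]_n) (pi / 2).
rewrite eqxx cos_pihalf addr0 => <-.
rewrite -[LHS]mul1e -integral_cst; last exact: measurable_torus.
apply: eq_integral => x _ /=; congr EFin.
by rewrite /zdot big1 ?mulr0 ?add0r ?cos_pihalf ?addr0// => k _; rewrite mxE mul0r.
Qed.

Section grid.
Variables (n L : nat).
Hypothesis L0 : (0 < L)%N.

Let point (w : {ffun 'I_n -> 'I_L}) : n.-tuple R := [tuple (w k)%:R / L%:R | k < n].

Let LR : L%:R != 0 :> R. Proof. by rewrite pnatr_eq0 -lt0n. Qed.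

Let point_inj : injective point.
Proof.
move=> w w' /(congr1 (fun t k => tnth t k)) E; apply/ffunP => k.
have := congr1 (fun h => h k) E; rewrite /= !tnth_mktuple => /(mulIf _).
by rewrite invr_eq0 LR => /(_ erefl)/eqP; rewrite eqr_nat => /eqP/val_inj.
Qed.

Let torus_gridE : torus_grid R n L = range point.
Proof.
apply/seteqP; split => [v [v01 vj]|_ [w _ <-]]; last first.
  split => k; rewrite tnth_mktuple; last by exists (w k : nat).
  by rewrite divr_ge0//= ltr_pdivrMr ?ltr0n// mul1r ltr_nat.
have wk k : exists j : 'I_L, tnth v k = (j : nat)%:R / L%:R.
  have [[j|j] vE] := vj k; have /andP[v0 v1] := v01 k.
    have jL : (j < L)%N by move: v1; rewrite vE ltr_pdivrMr ?ltr0n// mul1r ltr_nat.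
    by exists (Ordinal jL).
  move: v0; rewrite vE ler_pdivlMr ?ltr0n// mul0r NegzE mulrNz oppr_ge0 -pmulrn.
  by rewrite lern0.
exists [ffun k => projT1 (cid (wk k))] => //.
by apply: eq_from_tnth => k; rewrite tnth_mktuple ffunE; case: cid.
Qed.

Lemma measurable_torus_grid : measurable (torus_grid R n L).
Proof.
rewrite torus_gridE (_ : range point = \bigcup_(w in [set: {ffun 'I_n -> 'I_L}])
  \bigcap_(k in [set: 'I_n]) ((fun x : n.-tuple R => tnth x k) @^-1` [set tnth (point w) k])).
  apply: fin_bigcup_measurable => // w _; apply: fin_bigcap_measurable => // k _.
  by rewrite -[X in measurable X]setTI; exact: measurable_tnth.
apply/seteqP; split => [_ [w _ <-]|x [w _ xw]]; first by exists w.
by exists w => //; apply: eq_from_tnth => k; rewrite (xw k).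
Qed.

Lemma ge0_integral_grid (f : n.-tuple R -> \bar R) :
  measurable_fun (torus_grid R n L) f ->
  (forall x, (0 <= f x)%E) ->
  (\int[grid_measure R n L]_(x in torus_grid R n L) f x =
   (L%:R ^- n)%:E * \sum_w f (point w))%E.
Proof.
move=> mf f0.
pose x0 : n.-tuple R := [tuple of nseq n 0].
pose s := fset_set (torus_grid R n L).
have c0 : 0 <= (L%:R : R) ^- n by rewrite invr_ge0 exprn_ge0.
pose m0 : {measure set (n.-tuple R) -> \bar R} :=
  msum (fun i => dirac (nth x0 s i)) (size s).
pose m : {measure set (n.-tuple R) -> \bar R} := mscale (NngNum c0) m0.
have fsT : finite_set (torus_grid R n L) by exact: finite_torus_grid.
rewrite (@eq_measure_integral _ _ _ _ m); last first.
  move=> A mA _; rewrite /m /= /mscale /= /grid_measure; congr (_ * _)%E.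
  by rewrite fsbig_finite//= (big_nth x0) big_mkord.
rewrite ge0_integral_mscale//=; [|exact: measurable_torus_grid]; congr (_ * _)%E.
rewrite ge0_integral_measure_sum//; [|exact: measurable_torus_grid].
transitivity (\sum_(v \in torus_grid R n L) f v)%E; last first.
  rewrite torus_gridE fsbig_image; last by move=> w w' _ _; exact: point_inj.
  rewrite (_ : [set: _] = [set` enum {ffun 'I_n -> 'I_L}]).
    by rewrite -fsbig_seq ?enum_uniq// big_enum.
  by apply/seteqP; split => w //= _; rewrite mem_enum.
rewrite fsbig_finite//= (big_nth x0) big_mkord; apply: eq_bigr => i _.
rewrite integral_dirac//; [|exact: measurable_torus_grid].
rewrite diracE mem_set ?mul1e//.
have : nth x0 s i \in s by apply: mem_nth.
by rewrite in_fset_set// inE.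
Qed.

Let ordS_shift (k : 'I_n) (w : {ffun 'I_n -> 'I_L}) : {ffun 'I_n -> 'I_L} :=
  [ffun l => if l == k then ordS (w l) else w l].

Let ordS_shift_bij k : bijective (ordS_shift k).
Proof.
apply: injF_bij => w w' E; apply/ffunP => l.
have := congr1 (fun h : {ffun 'I_n -> 'I_L} => h l) E; rewrite !ffunE.
by case: ifP => // _; exact: (can_inj (@ordSK L)).
Qed.

Lemma grid_cos_sum (z : 'rV[int]_n) (c : R) : ~ (forall k, (L%:Z %| z 0%R k)%Z) ->
  \sum_w cos (2 * pi * zdot z (tnth (point w)) + c) = 0.
Proof.
move=> /existsNP[k /negP kz].
pose F c := \sum_w cos (2 * pi * zdot z (tnth (point w)) + c).
pose a : R := 2 * pi * ((z 0 k)%:~R / L%:R).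
(* Translating the [k]-th coordinate by [1 / L] leaves [F] invariant, while
   [F (c + a) + F (c - a) = 2 cos a F c] with [cos a <> 1]. *)
have Fa t : F (t + a) = F t.
  rewrite [RHS]/F (reindex (ordS_shift k)) /=; last exact: onW_bij.
  apply: eq_bigr => w _.
  (* The carry of the cyclic shift: 1 if the coordinate wraps from L - 1 to 0, and 0 otherwise. It
     changes the argument of the cosine by a multiple of 2 pi. *)
  pose q : nat := ((w k).+1 %/ L)%N.
  have -> : zdot z (tnth (point (ordS_shift k w))) =
      zdot z (tnth (point w)) + (z 0 k)%:~R / L%:R - (z 0 k * q%:Z)%:~R.
    rewrite /zdot (bigD1 k)//= [in RHS](bigD1 k)//=.
    rewrite (eq_bigr (fun l => (z 0 l)%:~R * tnth (point w) l)); last first.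
      by move=> l lk; rewrite !tnth_mktuple ffunE (negbTE lk).
    rewrite !tnth_mktuple ffunE eqxx /=.
    have E : (w k)%:R + 1 = q%:R * L%:R + ((w k).+1 %% L)%:R :> R.
      by rewrite -natrM -natrD /q -divn_eq natr1.
    have -> : (((w k).+1 %% L)%:R : R) = (w k)%:R + 1 - q%:R * L%:R by rewrite E; ring.
    rewrite intrM -pmulrn; field; exact: LR.
  rewrite -[LHS](cosD2pi_int _ (- (z 0 k * q%:Z))); congr cos.
  by rewrite /a intrN; ring.
have Fadd : F (c + a) + F (c - a) = 2 * cos a * F c.
  rewrite /F -big_split /= mulr_sumr; apply: eq_bigr => w _.
  by rewrite !addrA cosD cosB; ring.
have Fm : F (c - a) = F c by rewrite -(Fa (c - a)) subrK.
have : (1 - cos a) * F c = 0 by move: Fadd; rewrite Fa Fm; lra.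
move=> /eqP; rewrite mulf_eq0 => /orP[|/eqP//].
rewrite subr_eq0 => /eqP cosa; exfalso.
(* With r the remainder of z_k modulo L, cos a = 1 - 2 sin(pi r / L)^2. Since 0 < r < L the sine is
   positive, which contradicts cos a = 1. *)
pose r := `|(z 0%R k %% L)%Z|%N; pose q := (z 0%R k %/ L)%Z.
have L0' : L%:Z != 0 by rewrite eqz_nat -lt0n.
have rE : (z 0%R k %% L)%Z = r%:Z by rewrite /r gez0_abs// modz_ge0.
have zE : z 0 k = q * L%:Z + r%:Z by rewrite -rE; exact: divz_eq.
have r0 : (0 < r)%N.
  rewrite lt0n; apply: contra kz => /eqP r0.
  by rewrite zE r0 addr0 dvdz_mull.
have rL : (r < L)%N by have := ltz_mod (z 0 k) L0'; rewrite rE.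
have : cos a = 1 - sin (pi * (r%:R / L%:R)) ^+ 2 *+ 2.
  rewrite -(cosD2pi_int (a : R) (- q)).
  rewrite (_ : _ + _ = (pi * (r%:R / L%:R)) *+ 2).
    by rewrite cos_mulr2n cos2sin2 !mulr2n; ring.
  rewrite /a zE intrD intrM intrN -!pmulrn mulr2n; field; exact: LR.
have s0 : 0 < sin (pi * (r%:R / L%:R)) :> R.
  rewrite sin_gt0_pi// mulr_gt0 ?pi_gt0 ?divr_gt0 ?ltr0n//=.
  by rewrite gtr_pMr ?pi_gt0// ltr_pdivrMr ?ltr0n// mul1r ltr_nat.
by rewrite -cosa => H; have := exprn_gt0 2 s0; move: H; lra.
Qed.

Let card_points : (L%:R ^- n * (#|{ffun 'I_n -> 'I_L}|)%:R : R) = 1.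
Proof. by rewrite card_ffun !card_ord natrX mulVf// expf_neq0. Qed.

Lemma integral_grid_osc (z : 'rV[int]_n) (c : R) : ~ (forall k, (L%:Z %| z 0%R k)%Z) ->
  (\int[grid_measure R n L]_(x in torus_grid R n L)
     (1 + cos (2 * pi * zdot z (tnth x) + c))%:E = 1)%E.
Proof.
move=> Lz; rewrite ge0_integral_grid; last 2 first.
- exact: measurable_fun_torus_osc.
- by move=> x; rewrite lee_fin osc_ge0.
by rewrite sumEFin big_split /= grid_cos_sum// addr0 sumr_const -EFinM card_points.
Qed.

Lemma grid_measure_torus_grid : grid_measure R n L (torus_grid R n L) = 1%E.
Proof.
rewrite -[LHS]mul1e -integral_cst; last exact: measurable_torus_grid.
rewrite ge0_integral_grid//; first by rewrite sumEFin sumr_const -EFinM card_points.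
Qed.

End grid.

Section grid_finite.
Variables (n L : nat).

(** Finiteness provides the sigma-finite structure under which Tonelli is applied to the grid in the
    second moment formula. *)
Let grid_fin : fin_num_fun (grid_measure R n L).
Proof.
move=> A mA; rewrite /grid_measure fin_numM// fsbig_finite/=; last exact: finite_torus_grid.
by rewrite sum_fin_num; apply/allP => x /mapP[v _ ->]; rewrite diracE.
Qed.

HB.instance Definition _ := Measure_isFinite.Build _ _ _ (grid_measure R n L) grid_fin.

End grid_finite.

End oscillation.

(** * The second moment of the LQG measures *)

Section second_moment.
Context {R : realType} (n : nat).
Variables (Zhat : set 'rV[int]_n).
Hypothesis hZhat : half_lattice Zhat.

Lemma zdotN (z : 'rV[int]_n) (u : 'I_n -> R) : zdot (- z) u = - zdot z u.
Proof.
by rewrite /zdot -sumrN; apply: eq_bigr => k _; rewrite mxE intrN mulNr.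
Qed.

Lemma zdotB (z : 'rV[int]_n) (x y : n.-tuple R) :
  zdot z (fun k => tnth x k - tnth y k) = zdot z (tnth x) - zdot z (tnth y).
Proof. by rewrite /zdot -sumrB; apply: eq_bigr => k _; rewrite mulrBr. Qed.

Lemma intboxN L (z : 'rV[int]_n) : intbox n L (- z) = intbox n L z.
Proof.
rewrite /intbox /=; congr is_true; congr (_ * _ < _)%N; apply: eq_bigr => k _.
by rewrite mxE abszN.
Qed.

Lemma lambdaN L (z : 'rV[int]_n) : lambda R L (- z) = lambda R L z.
Proof.
rewrite /lambda; congr (_ * _); apply: eq_bigr => k _.
by rewrite mxE intrN mulrN mulNr sinN sqrrN.
Qed.

(** Exactly one of z and -z lies in [Zhat], so the pair carries one cosine and one sine of the same
    frequency and the subtraction formula for cos applies. *)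
Lemma phi_pair (z : 'rV[int]_n) (x y : n.-tuple R) : z != 0 ->
  phi Zhat z x * phi Zhat z y + phi Zhat (- z) x * phi Zhat (- z) y =
  2 * cos (2 * pi * zdot z (fun k => tnth x k - tnth y k)).
Proof.
move=> z0; have [hU hI] := hZhat.
have s2 : Num.sqrt 2 * Num.sqrt 2 = 2 :> R by rewrite -expr2 sqr_sqrtr.
have key (a b c e : R) : (Num.sqrt 2 * a) * (Num.sqrt 2 * b) + (Num.sqrt 2 * c) * (Num.sqrt 2 * e)
    = 2 * (a * b + c * e).
  have -> : (Num.sqrt 2 * a) * (Num.sqrt 2 * b) + (Num.sqrt 2 * c) * (Num.sqrt 2 * e)
    = Num.sqrt 2 * Num.sqrt 2 * (a * b + c * e) by ring.
  by rewrite s2.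
rewrite zdotB mulrBr cosB /phi !zdotN !mulrN !cosN !sinN.
have [zZ|zZ] := boolP (z \in Zhat).
  rewrite memNset; last first.
    move=> nz; suff : (set0 : set 'rV[int]_n) z by [].
    by rewrite -hI; split; [exact: set_mem|exists (- z); rewrite ?opprK].
  by rewrite key mulrNN.
have : (~` [set 0]) z by apply/eqP.
rewrite hU => -[/mem_set zZ'|[z' z'Z zE]]; first by rewrite zZ' in zZ.
have -> : - z \in Zhat by rewrite -zE opprK; exact: mem_set.
by rewrite key [X in 2 * X]addrC.
Qed.

Let box L := fset_set (intbox n L `\ 0).

Lemma finite_intbox0 L : finite_set (intbox n L `\ 0).
Proof. by apply: (sub_finite_set _ (finite_intbox n L)) => z []. Qed.

Lemma fsbig_intbox0N L (F : 'rV[int]_n -> R) :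
  \sum_(z \in intbox n L `\ 0) F (- z) = \sum_(z \in intbox n L `\ 0) F z.
Proof.
rewrite [RHS](reindex_fsbig -%R (intbox n L `\ 0) (intbox n L `\ 0))//.
split.
- move=> z [zA z0]; split; first by rewrite intboxN.
  by move=> /= /eqP; rewrite oppr_eq0 => /eqP.
- by move=> z z' _ _; exact: oppr_inj.
- move=> z [zA z0]; exists (- z); last by rewrite opprK.
  split; first by rewrite intboxN.
  by move=> /= /eqP; rewrite oppr_eq0 => /eqP.
Qed.

(** The two sums do not agree term by term, only after pairing z with -z; hence the left one is
    added to its own reflection and the result halved. *)
Lemma sum_phi_cov L (x y : n.-tuple R) :
  \sum_(z <- box L) lambda R L z `^ (- (n%:R / 2)) * (phi Zhat z x * phi Zhat z y) =
  \sum_(z \in intbox n L `\ 0) lambda R L z `^ (- (n%:R / 2)) *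
    cos (2 * pi * zdot z (fun k => tnth x k - tnth y k)).
Proof.
rewrite -fsbig_finite/=; last exact: finite_intbox0.
set A := intbox n L `\ 0; set F := fun z => _ * _.
have FN : \sum_(z \in A) F (- z) = \sum_(z \in A) F z by exact: fsbig_intbox0N.
suff : \sum_(z \in A) F z + \sum_(z \in A) F z =
   2 * \sum_(z \in A) (lambda R L z `^ (- (n%:R / 2)) *
    cos (2 * pi * zdot z (fun k => tnth x k - tnth y k))) by lra.
rewrite -{2}FN; rewrite !fsbig_finite/=; do ?exact: finite_intbox0.
rewrite -big_split mulr_sumr /= big_seq [RHS]big_seq; apply: eq_bigr => z.
rewrite in_fset_set; last exact: finite_intbox0.
move=> /set_mem[_ /eqP z0]; rewrite /F lambdaN -mulrDr phi_pair//.
by rewrite mulrCA.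
Qed.

Hypothesis a0 : 0 < a_const R n.
Context {d} {Omega : measurableType d} (P : probability Omega R).
Variable xi : 'rV[int]_n -> {RV P >-> R}.
Hypothesis hxi : iid_standard_normal P (~` [set 0]) xi.
Variables (gamma : R) (L : nat).

Let h w := fourier_field Zhat L (fun z => xi z w).
Let k := @fourier_cov R n L.

(** The exponent is a linear form in the independent normal variables with coefficients [c z]. Half
    the sum of their squares is the exponent on the right, since the products of [phi] sum to the
    covariance. *)
Lemma expectation_exp_field2 (x y : n.-tuple R) :
  (\int[P]_w (expR (gamma * h w x + gamma * h w y))%:E =
   (expR (gamma ^+ 2 / 2 * (k x x + k y y + 2 * k x y)))%:E)%E.
Proof.
pose c z := gamma * a_const R n `^ (- 2^-1) * lambda R L z `^ (- (n%:R / 4)) *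
   (phi Zhat z x + phi Zhat z y).
transitivity (\int[P]_w (expR (\sum_(z <- box L) c z * xi z w))%:E)%E.
  apply: eq_integral => w _; congr (expR _)%:E.
  rewrite /h /fourier_field !fsbig_finite/=; do ?exact: finite_intbox0.
  rewrite -!mulrDr -big_split /= !mulr_sumr; apply: eq_bigr => z _.
  by rewrite /c; ring.
rewrite (iid_normal_mgf (D := ~` [set 0]))//; last first.
  by move=> z; rewrite in_fset_set; [move=> /set_mem[]|exact: finite_intbox0].
congr (expR _)%:E.
have cE z : c z ^+ 2 = gamma ^+ 2 * (a_const R n)^-1 * (lambda R L z `^ (- (n%:R / 2)) *
    (phi Zhat z x * phi Zhat z x) + lambda R L z `^ (- (n%:R / 2)) *
    (phi Zhat z y * phi Zhat z y) + 2 * (lambda R L z `^ (- (n%:R / 2)) *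
    (phi Zhat z x * phi Zhat z y))).
  have E1 : (a_const R n `^ (- 2^-1)) ^+ 2 = (a_const R n)^-1.
    rewrite -powR_mulrn ?powR_ge0// -powRrM mulNr mulVf ?pnatr_eq0//.
    by rewrite powR_inv1// ltW.
  have E2 : (lambda R L z `^ (- (n%:R / 4))) ^+ 2 = lambda R L z `^ (- (n%:R / 2)).
    rewrite -powR_mulrn ?powR_ge0// -powRrM; congr (_ `^ _).
    by field.
  by rewrite /c !exprMn E1 E2; ring.
under eq_bigr do rewrite cE.
rewrite -mulr_sumr !big_split /= -mulr_sumr !sum_phi_cov /k /fourier_cov.
by ring.
Qed.

Section measure.
Variable m : {sigma_finite_measure set (n.-tuple R) -> \bar R}.
Variable A : set (n.-tuple R).
Hypothesis mA : measurable A.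

Lemma measurable_phi z D : measurable_fun D (phi Zhat z : n.-tuple R -> R).
Proof.
apply: measurable_funTS; rewrite /phi.
have mz : measurable_fun setT (fun x : n.-tuple R => 2 * pi * zdot z (tnth x)).
  by apply: measurable_funM => //; exact: measurable_zdot_tnth.
case: (z \in Zhat); apply: measurable_funM => //.
  exact: (measurableT_comp measurable_cos).
exact: (measurableT_comp measurable_sin).
Qed.

(** The kernel depends on x - y only. Its diagonal is thus a constant, which removes x from the
    normalisation when measurability is checked. *)
Lemma fourier_cov_diag x : k x x = k [tuple of nseq n 0] [tuple of nseq n 0].
Proof.
rewrite /k /fourier_cov; congr (_ * _); apply: eq_fsbigr => z _.
by congr (_ * cos (_ * _)); apply: eq_bigr => i _; rewrite !subrr.
Qed.

Let f w x := expR (gamma * h w x - gamma ^+ 2 / 2 * k x x).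

Let measurable_f : measurable_fun setT (fun p : Omega * n.-tuple R => f p.1 p.2).
Proof.
rewrite /f; under eq_fun do rewrite fourier_cov_diag.
apply: measurableT_comp => //; apply: measurable_funB => //.
apply: measurable_funM => //; rewrite /h /fourier_field.
apply: measurable_funM => //.
rewrite (_ : (fun _ => _) = (fun p : Omega * n.-tuple R => \sum_(z <- box L)
    lambda R L z `^ (- (n%:R / 4)) * xi z p.1 * phi Zhat z p.2)); last first.
  by apply/funext => p; rewrite fsbig_finite//; exact: finite_intbox0.
apply: measurable_sum => z; apply: measurable_funM.
  apply: measurable_funM => //.
  exact: (measurableT_comp (f := xi z) (g := fst)).
by apply: (measurableT_comp (f := phi Zhat z)); [exact: measurable_phi|exact: measurable_snd].
Qed.

(** The square is a double integral, and two uses of Tonelli bring the expectation inside. The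
    normalising factors cancel k(x, x) + k(y, y) in the Gaussian exponent, and the cross term
    remains. *)
Lemma second_moment_lqg :
  (\int[P]_w `|lqg m gamma (h w) k A| ^+ 2 =
   \int[m]_(x in A) \int[m]_(y in A) (expR (gamma ^+ 2 * k x y))%:E)%E.
Proof.
pose F w x := ((f w x)%:E * (\1_A x)%:E)%E.
have F0 w x : (0 <= F w x)%E by rewrite mule_ge0// lee_fin ?expR_ge0.
have lqgE w : lqg m gamma (h w) k A = (\int[m]_x F w x)%E.
  rewrite /lqg integral_mkcond; apply: eq_integral => x _.
  by rewrite /patch /F indicE; case: ifP; rewrite ?mule1 ?mule0.
have mF : measurable_fun setT (fun p : Omega * n.-tuple R => F p.1 p.2).
  apply: emeasurable_funM; first by apply/measurable_EFinP; exact: measurable_f.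
  apply/measurable_EFinP.
  by apply: (@measurableT_comp _ _ _ _ _ _ (\1_A : _ -> R));
    [exact: measurable_indic|exact: measurable_snd].
have mFw w : measurable_fun setT (F w).
  exact: (measurableT_comp mF (measurable_pair1 w)).
pose F1 w : \bar R := (\int[m]_y F w y)%E.
have mF1 : measurable_fun setT F1.
  exact: (measurable_fun_fubini_tonelli_F (m2 := m) (fun p => F p.1 p.2)).
have F10 w : (0 <= F1 w)%E by exact: integral_ge0.
transitivity (\int[P]_w \int[m]_x (F w x * F1 w))%E.
  apply: eq_integral => w _; rewrite lqgE gee0_abs; last exact: F10.
  rewrite expe2.
  rewrite -ge0_integralZr//.
  exact: F10.
rewrite (fubini_tonelli (m1 := P) (m2 := m) (fun p => F p.1 p.2 * F1 p.1)%E)/=; last 2 first.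
- by apply: emeasurable_funM => //; exact: (measurableT_comp mF1 measurable_fst).
- by move=> p; rewrite mule_ge0.
transitivity (\int[m]_x \int[P]_w \int[m]_y (F w x * F w y))%E.
  apply: eq_integral => x _; apply: eq_integral => w _; rewrite ge0_integralZl//.
transitivity (\int[m]_x \int[m]_y \int[P]_w (F w x * F w y))%E.
  apply: eq_integral => x _.
  rewrite (fubini_tonelli (m1 := P) (m2 := m) (fun p => F p.1 x * F p.1 p.2)%E)//=.
  - apply: emeasurable_funM => //.
    apply: (measurableT_comp (f := fun w => F w x) (g := fst)) => //.
    exact: (measurableT_comp mF (measurable_pair2 x)).
  - by move=> p; rewrite mule_ge0.
rewrite [RHS]integral_mkcond; apply: eq_integral => x _.
transitivity (\int[m]_y ((\1_A x * \1_A y)%:E * \int[P]_w (f w x * f w y)%:E))%E.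
  apply: eq_integral => y _; rewrite -ge0_integralZl//.
  - by apply: eq_integral => w _; rewrite /F -!EFinM; congr EFin; ring.
  - apply/measurable_EFinP; apply: measurable_funM.
      exact: (measurableT_comp measurable_f (measurable_pair2 x)).
    exact: (measurableT_comp measurable_f (measurable_pair2 y)).
  - by move=> w _; rewrite lee_fin mulr_ge0// expR_ge0.
have fE y : (\int[P]_w (f w x * f w y)%:E = (expR (gamma ^+ 2 * k x y))%:E)%E.
  pose C := expR (- (gamma ^+ 2 / 2 * (k x x + k y y))).
  transitivity (\int[P]_w (C%:E * (expR (gamma * h w x + gamma * h w y))%:E))%E.
    apply: eq_integral => w _; rewrite -EFinM /C /f -!expRD; congr (expR _)%:E.
    by ring.
  rewrite ge0_integralZl//; last 2 first.
  - have mfz z : measurable_fun setT (fun w => f w z).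
      exact: (measurableT_comp measurable_f (measurable_pair2 z)).
    rewrite (_ : (fun _ => _) = (fun w => (C^-1 * (f w x * f w y))%:E)).
      by apply/measurable_EFinP; apply: measurable_funM => //; apply: measurable_funM.
    apply/funext => w; congr EFin; rewrite /C /f -expRN -!expRD; congr expR.
    by ring.
  - by rewrite lee_fin expR_ge0.
  rewrite expectation_exp_field2 -EFinM -expRD; congr (expR _)%:E.
  by field.
rewrite /patch; case: ifPn => xA; last first.
  by apply: integral0_eq => y _; rewrite indicE (negbTE xA) mul0r mul0e.
rewrite [RHS]integral_mkcond; apply: eq_integral => y _.
by rewrite fE !indicE xA mul1r /patch; case: ifP; rewrite ?mul1e ?mul0e.
Qed.

End measure.
End second_moment.

(** * Powers of trigonometric sums *)

Section trig_power.
Variables (R : realType) (I : finType) (f theta : I -> R).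

Let e (t : R) : R[i] := (cos t +i* sin t)%C.

Let eD s t : e (s + t) = e s * e t.
Proof. by rewrite /e cosD sinD; congr (_ +i* _)%C; rewrite addrC. Qed.

Let e_sum J (r : seq J) (F : J -> R) : e (\sum_(i <- r) F i) = \prod_(i <- r) e (F i).
Proof.
apply: (big_morph e eD); by rewrite /e cos0 sin0.
Qed.

(** The vanishing sine sum says that the sum of f_i exp(i theta_i) is real and equals the cosine
    sum. Its power expands through the multiplicativity of the exponential, and real parts are
    taken. *)
Lemma cos_sum_pow j : \sum_i f i * sin (theta i) = 0 ->
  (\sum_i f i * cos (theta i)) ^+ j =
  \sum_(w : {ffun 'I_j -> I}) (\prod_l f (w l)) * cos (\sum_l theta (w l)).
Proof.
move=> s0; set K := \sum_i _.
have KE : (K%:C)%C = \sum_i (f i)%:C%C * e (theta i).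
  rewrite (eq_bigr (fun i => (f i * cos (theta i) +i* (f i * sin (theta i)))%C)); last first.
    by move=> i _; rewrite /e /=; simpc.
  rewrite -[LHS]/(K +i* 0)%C -s0 /K.
  by apply/eqP; rewrite eq_complex !raddf_sum /= !eqxx.
have : (K ^+ j)%:C%C = \sum_(w : {ffun 'I_j -> I})
    ((\prod_l f (w l))%:C * e (\sum_l theta (w l)))%C.
  rewrite rmorphXn /= -[X in _ ^+ X](card_ord j) -prodr_const KE.
  rewrite bigA_distr_bigA; apply: eq_bigr => w _.
  by rewrite big_split /= rmorph_prod e_sum.
move/(congr1 (fun x : R[i] => complex.Re x)) => /= ->.
rewrite raddf_sum; apply: eq_bigr => w _ /=.
by rewrite mul0r subr0.
Qed.

End trig_power.

(** * Sums of products over constrained tuples *)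

Section young.
Variables (R : realType).

(* AM-GM for the [j + 2] products in which one factor is left out. *)
Lemma prod_le_mean_pow j (a : 'I_j.+2 -> R) : (forall l, 0 <= a l) ->
  \prod_l a l <= j.+2%:R^-1 * \sum_i \prod_(l | l != i) a l `^ (j.+2%:R / j.+1%:R).
Proof.
move=> a0; set p := _ / _; set b := fun i => \prod_(l | l != i) a l `^ p.
have b0 i : 0 <= b i by apply: prodr_ge0 => l _; exact: powR_ge0.
have := (@leif_AGM _ _ predT b (fun i _ => b0 i)).1.
rewrite cardT size_enum_ord.
have -> : \prod_i b i = (\prod_l a l) ^+ j.+2.
  rewrite /b (exchange_big_dep xpredT) //= -prodrXl; apply: eq_bigr => l _.
  rewrite (eq_bigl (fun i => i \in predC1 l)) => [|i]; last by rewrite inE eq_sym.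
  rewrite prodr_const cardC1 card_ord /=.
  rewrite -powR_mulrn ?powR_ge0// -powRrM /p divfK ?pnatr_eq0//.
  by rewrite powR_mulrn.
rewrite ler_pXn2r//= ?nnegrE.
- by rewrite mulrC.
- by apply: prodr_ge0.
- by rewrite mulr_ge0// ?sumr_ge0// invr_ge0.
Qed.

Variables (I : finType).

(** An admissible tuple is recoverable after erasing its [i]-th entry, so the sum is dominated by
    the one over all tuples of the other [j] entries, and this factors. *)
Lemma sum_prod_neq_le j (i : 'I_j.+1) (g : I -> R) (ok : pred {ffun 'I_j.+1 -> I}) :
  (forall v, 0 <= g v) ->
  (forall w w', ok w -> ok w' -> (forall l, l != i -> w l = w' l) -> w = w') ->
  \sum_(w | ok w) \prod_(l | l != i) g (w l) <= (\sum_v g v) ^+ j.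
Proof.
move=> g0 ok_inj.
(* Erasing is encoded by the value [inl tt] at [i], which keeps the index type. [G] vanishes on
   values of the wrong kind, so summing over all functions into [unit + I] counts only the erased
   tuples. *)
pose h (w : {ffun 'I_j.+1 -> I}) : {ffun 'I_j.+1 -> unit + I} :=
  [ffun l => if l == i then inl tt else inr (w l)].
pose G l (o : unit + I) : R :=
  match o with inl _ => (l == i)%:R | inr v => if l == i then 0 else g v end.
have G0 l o : 0 <= G l o by case: o => [_|v] /=; [rewrite ler0n | case: ifP].
have hE (w : {ffun 'I_j.+1 -> I}) : \prod_(l | l != i) g (w l) = \prod_l G l (h w l).
  rewrite [RHS](bigD1 i)//= ffunE eqxx /= eqxx mul1r.
  by apply: eq_bigr => l li; rewrite ffunE (negbTE li) /= (negbTE li).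
have h_inj : {in ok &, injective h}.
  move=> w w' okw okw' hh; apply: ok_inj => // l li.
  by have /ffunP/(_ l) := hh; rewrite !ffunE (negbTE li) => -[].
under eq_bigr do rewrite hE.
rewrite -(big_imset (fun w' : {ffun 'I_j.+1 -> unit + I} => \prod_l G l (w' l)) h_inj) /=.
apply: (@le_trans _ _ (\sum_(w' : {ffun 'I_j.+1 -> unit + I}) \prod_l G l (w' l))).
  rewrite [leRHS](bigID (mem (h @: ok)%SET))/= lerDl sumr_ge0// => w _.
  by apply: prodr_ge0.
rewrite -(bigA_distr_bigA G) (bigD1 i)//=.
have -> : \sum_o G i o = 1.
  by rewrite big_sumType /= eqxx [X in _ + X]big1 ?addr0// sumr_const card_unit.
rewrite mul1r (eq_bigr (fun=> \sum_v g v)) => [|l li].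
  rewrite (eq_bigl (fun l => l \in predC1 i)) => [|l]; last by rewrite inE.
  by rewrite prodr_const cardC1 card_ord.
rewrite big_sumType /= big1 ?add0r => [|u _]; last by rewrite (negbTE li).
by apply: eq_bigr => v _; rewrite (negbTE li).
Qed.

(** AM-GM trades the full product for the mean of the products with one factor omitted, each of
    which is summed freely. The exponent is forced: every factor occurs in j + 1 of the j + 2
    products. *)
Lemma constrained_prod_le j (f : I -> R) (ok : pred {ffun 'I_j.+2 -> I}) :
  (forall v, 0 <= f v) ->
  (forall i w w', ok w -> ok w' -> (forall l, l != i -> w l = w' l) -> w = w') ->
  \sum_(w | ok w) \prod_l f (w l) <=
    (\sum_v f v `^ (j.+2%:R / j.+1%:R)) ^+ j.+1.
Proof.
move=> f0 ok_inj; set p := _ / _.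
apply: (@le_trans _ _ (\sum_(w | ok w) j.+2%:R^-1 *
    \sum_i \prod_(l | l != i) f (w l) `^ p)).
  by apply: ler_sum => w _; apply: prod_le_mean_pow => l.
rewrite -mulr_sumr exchange_big/= mulrC ler_pdivrMr ?ltr0n//.
apply: (@le_trans _ _ (\sum_(i < j.+2) (\sum_v f v `^ p) ^+ j.+1)).
  apply: ler_sum => i _; apply: (sum_prod_neq_le (i := i) (g := fun v => f v `^ p)) => [v|].
    exact: powR_ge0.
  exact: ok_inj.
by rewrite sumr_const card_ord mulr_natr.
Qed.

End young.

(** * The Gamma integral *)

Section gamma_function.
Context {R : realType}.
Notation mu := (@lebesgue_measure R).

(** Lebesgue measure is [c] times its image under multiplication by [c], because the two agree on
    half-open intervals. *)
Lemma ge0_integral_scale (c : R) (g : R -> R) : 0 < c ->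
  measurable_fun setT g -> (forall x, 0 <= g x) ->
  (\int[mu]_x (g x)%:E = c%:E * \int[mu]_x (g (c * x))%:E)%E.
Proof.
move=> c0 mg g0.
have mc : measurable_fun setT (fun x : measurableTypeR R => c * x : measurableTypeR R).
  exact: measurable_funM.
pose m : {measure set (measurableTypeR R) -> \bar R} :=
  mscale (NngNum (ltW c0))
    (measure_function_pushforward__canonical__measure_function_Measure mu mc).
have muE A : measurable A -> mu A = m A.
  apply: lebesgue_measure_unique => _ [[a b] _ <-].
  rewrite /m /= /mscale /= /pushforward /=.
  rewrite (_ : _ @^-1` _ = `](c^-1 * a), (c^-1 * b)]%classic); last first.
    apply/seteqP; split => x /=; rewrite !in_itv /=;
    by rewrite ltr_pdivrMl// ler_pdivlMl.
  rewrite !lebesgue_measure_itv/= !lte_fin ltr_pM2l ?invr_gt0//.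
  by case: ifPn => _; rewrite ?mule0// -!EFinB -EFinM -mulrBr mulrA mulfV ?gt_eqF// mul1r.
rewrite (@eq_measure_integral _ _ _ _ m); last by move=> A mA _; exact: muE.
have mgE : measurable_fun [set: R] (EFin \o g) by exact/measurable_EFinP.
rewrite ge0_integral_mscale//=; last by move=> x _; rewrite lee_fin.
congr (_ * _)%E; etransitivity.
  apply: (ge0_integral_pushforward mc mu measurableT mgE) => y _.
  by rewrite lee_fin.
by rewrite preimage_setT.
Qed.

Lemma measurable_powR_expR (s c : R) D :
  measurable_fun D (fun t : R => t `^ s * expR (- (c * t))).
Proof.
apply: measurable_funTS; apply: measurable_funM; first exact: measurable_powR.
by apply: measurableT_comp => //; apply: measurableT_comp => //; exact: measurable_funM.
Qed.

Lemma integral_powR_expR (s c : R) : 0 < c ->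
  (\int[mu]_(t in `]0%R, +oo[) (t `^ (s - 1) * expR (- (c * t)))%:E =
   (c `^ (- s))%:E * \int[mu]_(t in `]0%R, +oo[) (t `^ (s - 1) * expR (- t))%:E)%E.
Proof.
move=> c0.
pose g (t : R) : R := ((fun t => t `^ (s - 1) * expR (- t)) \_ `]0, +oo[%classic) t.
have g0 t : 0 <= g t by rewrite /g /patch; case: ifP => // _; rewrite mulr_ge0 ?powR_ge0 ?expR_ge0.
have mg : measurable_fun setT g.
  apply: (measurable_restrictT _ _).1 => //.
  rewrite (_ : (fun _ => _) = fun t => t `^ (s - 1) * expR (- (1 * t))).
    exact: measurable_powR_expR.
  by apply/funext => t; rewrite mul1r.
have -> : (\int[mu]_(t in `]0%R, +oo[) (t `^ (s - 1) * expR (- t))%:E = \int[mu]_t (g t)%:E)%E.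
  by rewrite integral_mkcond; apply: eq_integral => t _; rewrite /g /patch; case: ifP.
rewrite (ge0_integral_scale c0)// muleA -EFinM.
rewrite (_ : _ * c = c `^ (- (s - 1))); last first.
  rewrite (_ : - (s - 1) = - s + 1); last by ring.
  by rewrite powRD ?powRr1 ?(ltW c0)// (gt_eqF c0) implybT.
rewrite -ge0_integralZl//; last 3 first.
- apply/measurable_EFinP; apply: (measurableT_comp mg); exact: measurable_funM.
- by move=> t _; rewrite lee_fin.
- by rewrite lee_fin powR_ge0.
rewrite [LHS]integral_mkcond; apply: eq_integral => t _; rewrite /g /patch !mem_setE !in_itv /= !andbT.
rewrite pmulr_rgt0//; case: ifPn => t0; last by rewrite mule0.
rewrite -EFinM powRM ?ltW// mulrA mulrA -powRD ?(gt_eqF c0) ?implybT//.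
by rewrite addNr powRr0 mul1r.
Qed.

(** For a < 1 the integrand is singular at 0, so the fundamental theorem is applied on [1/(k+1), 1]
    and the limit is taken by monotone convergence. *)
Lemma integral01_powR_le (a : R) : 0 < a ->
  (\int[mu]_(t in `]0%R, 1%R]) (t `^ (a - 1))%:E <= (a^-1)%:E)%E.
Proof.
move=> a0.
pose I (k : nat) : set R := `[k.+1%:R^-1, 1]%classic.
have IU : `]0%R, 1%R]%classic = \bigcup_k I k.
  apply/seteqP; split => x /=.
    rewrite in_itv /= => /andP[x0 x1]; exists (Num.truncn x^-1) => //.
    rewrite /I /= in_itv /= x1 andbT invf_ple ?posrE ?ltr0n//.
    by rewrite ltW// truncnS_gt.
  move=> [k _]; rewrite /I /= !in_itv /= => /andP[kx ->].
  by rewrite andbT; apply: lt_le_trans kx; rewrite invr_gt0.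
have mI k : measurable (I k) by exact: measurable_itv.
have ndI : nondecreasing_seq I.
  move=> k l kl; apply/subsetPset => x /=; rewrite /I /= !in_itv /= => /andP[kx ->].
  by rewrite andbT; apply: le_trans kx; rewrite lef_pV2 ?posrE ?ltr0n// ler_nat ltnS.
have mp D : measurable_fun D (fun t : R => (t `^ (a - 1))%:E).
  by apply: measurable_funTS; apply/measurable_EFinP; exact: measurable_powR.
have cv : (\int[mu]_(x in I k) (x `^ (a - 1))%:E)%E @[k --> \oo] -->
    (\int[mu]_(x in \bigcup_k I k) (x `^ (a - 1))%:E)%E.
  apply: ge0_nondecreasing_set_cvg_integral => //.
    by move=> k; exact: mp.
  by move=> k x _; rewrite lee_fin powR_ge0.
rewrite IU -(cvg_lim _ cv)//; apply: lime_le; first by apply/cvg_ex; eexists; exact: cv.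
apply: nearW => k; rewrite /I.
(* For k = 0 the interval is the single point 1, where the fundamental theorem, stated for proper
   intervals, does not apply. *)
case: k => [|k].
  by rewrite invr1 set_itv1 integral_set1 lee_fin invr_ge0 ltW.
pose F (t : R) : R := a^-1 * t `^ a.
have pos (x : R) : x \in `]k.+2%:R^-1, 1[ -> 0 < x.
  by rewrite in_itv /= => /andP[kx _]; apply: lt_trans kx; rewrite invr_gt0.
have dF (x : R) : 0 < x -> is_derive x 1 F (x `^ (a - 1)).
  move=> x0; have := is_derive1_powR a x0 => dp.
  apply: is_derive_eq; rewrite ?scaler0 ?addr0 ?add0r -[_ *: _]/(_ * _).
  by rewrite mulrA mulVf ?mul1r// gt_eqF.
have cF (x : R) : 0 < x -> F @ x --> F x.
  move=> x0; apply: differentiable_continuous; apply/derivable1_diffP.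
  by have [] := dF x x0.
have k0 : 0 < k.+2%:R^-1 :> R by rewrite invr_gt0.
rewrite (@continuous_FTC2 _ (fun t => t `^ (a - 1)) F)//.
- rewrite -EFinB lee_fin /F powR1 mulr1 lerBlDr lerDl mulr_ge0 ?powR_ge0//.
  by rewrite invr_ge0 ltW.
- by rewrite invf_lt1 ?ltr0n// ltr1n.
- apply: continuous_in_subspaceT => x.
  rewrite inE /= in_itv /= => /andP[kx _].
  apply: differentiable_continuous; apply/derivable1_diffP; apply: derivable_powR.
  by rewrite in_itv /= andbT; apply: lt_le_trans kx.
- split.
  + by move=> x /pos x0; have [] := dF x x0.
  + by apply: cvg_at_right_filter; exact: cF.
  + by apply: cvg_at_left_filter; exact: cF.
- by move=> x /pos x0; rewrite derive1E; have [_ ->] := dF x x0.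
Qed.

Lemma integral_indic01_powR_le (a : R) : 0 < a ->
  (\int[mu]_(t in `]0%R, +oo[) (\1_(`]0%R, 1%R]%classic) t * t `^ (a - 1))%:E <= (a^-1)%:E)%E.
Proof.
move=> a0; rewrite (le_trans _ (integral01_powR_le a0))//.
rewrite integral_mkcond [leRHS]integral_mkcond le_eqVlt; apply/orP; left; apply/eqP.
apply: eq_integral => t _; rewrite /patch indicE !mem_setE !in_itv /= andbT.
by case: (0 < t); case: (t <= 1) => //=; rewrite ?mul1r ?mul0r.
Qed.

Lemma measurable_indic01_powR (a : R) D :
  measurable_fun D (fun t : R => \1_(`]0%R, 1%R]%classic) t * t `^ (a - 1)).
Proof.
apply: measurable_funTS; apply: measurable_funM; last exact: measurable_powR.
exact: measurable_indic.
Qed.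

(** A common majorant: two power singularities on (0, 1] and an exponential tail. It yields both the
    finiteness of the Gamma integral and the bound on the lattice sums. *)
Lemma integral_gamma_type_le (f : R -> R) (A a B b C c s : R) :
  0 <= A -> 0 <= B -> 0 <= C -> 0 < a -> 0 < b -> 0 < c ->
  measurable_fun setT f -> (forall t, 0 < t -> 0 <= f t) ->
  (forall t, 0 < t -> f t <= \1_(`]0%R, 1%R]%classic) t * (A * t `^ (a - 1) + B * t `^ (b - 1))
      + C * (t `^ (s - 1) * expR (- (c * t)))) ->
  (\int[mu]_(t in `]0%R, +oo[) (f t)%:E <= (A / a + B / b)%:E +
     (C * c `^ (- s))%:E *
     \int[mu]_(t in `]0%R, +oo[) (t `^ (s - 1) * expR (- t))%:E)%E.
Proof.
move=> A0 B0 C0 a0 b0 c0 mf f0 fle.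
pose E a t : R := \1_(`]0%R, 1%R]%classic) t * t `^ (a - 1).
pose H (t : R) : R := t `^ (s - 1) * expR (- (c * t)).
have E0 r t : 0 <= E r t by rewrite mulr_ge0 ?powR_ge0.
have H0 t : 0 <= H t by rewrite mulr_ge0 ?powR_ge0 ?expR_ge0.
have mE r D : measurable_fun D (fun t => (E r t)%:E).
  by apply/measurable_EFinP; exact: measurable_indic01_powR.
have mH D : measurable_fun D (fun t => (H t)%:E).
  by apply/measurable_EFinP; exact: measurable_powR_expR.
apply: (@le_trans _ _ (\int[mu]_(t in `]0%R, +oo[)
   (A%:E * (E a t)%:E + B%:E * (E b t)%:E + C%:E * (H t)%:E))%E).
  apply: ge0_le_integral => //.
  - by move=> t; rewrite /= in_itv /= andbT => t0; rewrite lee_fin f0.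
  - by apply: measurable_funTS; apply/measurable_EFinP.
  - apply: emeasurable_funD; last by apply: measurable_funeM; exact: mH.
    by apply: emeasurable_funD; apply: measurable_funeM; exact: mE.
  - move=> t; rewrite /= in_itv /= andbT => t0.
    rewrite -!EFinM -!EFinD lee_fin; apply: le_trans (fle t t0) _.
    by rewrite /E /H le_eqVlt; apply/orP; left; apply/eqP; ring.
have hE r D0 t : 0 <= D0 -> (0 <= D0%:E * (E r t)%:E)%E.
  by move=> d0; rewrite -EFinM lee_fin mulr_ge0.
rewrite ge0_integralD//=; last 4 first.
- by move=> t _; rewrite adde_ge0// hE.
- by apply: emeasurable_funD; apply: measurable_funeM; exact: mE.
- by move=> t _; rewrite -EFinM lee_fin mulr_ge0.
- by apply: measurable_funeM; exact: mH.
rewrite ge0_integralD//=; last 4 first.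
- by move=> t _; rewrite hE.
- by apply: measurable_funeM; exact: mE.
- by move=> t _; rewrite hE.
- by apply: measurable_funeM; exact: mE.
rewrite !ge0_integralZl//=; do ?[exact: mE|exact: mH|by move=> t _; rewrite lee_fin].
rewrite integral_powR_expR// muleA -EFinM leeD2r// EFinD.
by apply: leeD; rewrite EFinM lee_wpmul2l ?lee_fin//; exact: integral_indic01_powR_le.
Qed.

Lemma integral_expRN : (\int[mu]_(t in `]0%R, +oo[) (expR (- t))%:E = 1)%E.
Proof.
rewrite -(@integral_exponential_pdf R 1)// integral_itv_obnd_cbnd; last first.
  apply/measurable_EFinP; apply: measurable_funTS; apply: measurableT_comp => //.
rewrite integral_mkcond; apply: eq_integral => t _.
by rewrite /exponential_pdf /patch; case: ifP => // _; rewrite mul1r mulN1r.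
Qed.

Notation gammaE s := (\int[mu]_(t in `]0%R, +oo[) (t `^ (s - 1) * expR (- t))%:E)%E.

Lemma gammaE1 : gammaE 1 = 1%E.
Proof.
rewrite -integral_expRN; apply: eq_integral => t _.
by rewrite subrr powRr0 mul1r.
Qed.

Lemma pow_div_fact_le_expR (x : R) m : 0 <= x -> x ^+ m / m`!%:R <= expR x.
Proof.
move=> x0; case: m => [|m].
  by rewrite expr0 fact0 divr1 -expR0 ler_expR.
by apply: le_trans (expR_ge1Dxn m x0); rewrite lerDr.
Qed.

Lemma gammaE_lty (s : R) : 0 < s -> (gammaE s < +oo)%E.
Proof.
(* As m > s, for t > 1 the power t^(s-1) is at most t^m, and one term of the exponential series
   gives t^m <= 2^m m! exp(t/2). Half of the exponential decay is thereby kept. *)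
move=> s0; pose m := (Num.truncn s).+1; pose C : R := 2 ^+ m * m`!%:R.
have C0 : 0 <= C by rewrite mulr_ge0.
have h0 : 0 < 2^-1 :> R by [].
apply: (@le_lt_trans _ _ ((1 / s + 0 / 1)%:E + (C * 2^-1 `^ (- 1))%:E * gammaE 1)%E);
  last by rewrite gammaE1 mule1 -EFinD ltry.
apply: integral_gamma_type_le => //.
- have := @measurable_powR_expR (s - 1) 1 setT.
  by rewrite (_ : (fun _ => _) = (fun t => t `^ (s - 1) * expR (- t)))//; apply/funext => t; rewrite mul1r.
- by move=> t _; rewrite mulr_ge0 ?powR_ge0 ?expR_ge0.
move=> t t0; rewrite indicE mem_setE in_itv /= t0 /= mul1r mul0r addr0 subrr powRr0 mul1r.
have [t1|t1] := leP t 1.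
  rewrite mul1r -[leLHS]addr0 lerD//; last by rewrite mulr_ge0 ?expR_ge0.
  by rewrite ler_piMr ?powR_ge0// expR_le1 oppr_le0 ltW.
rewrite mul0r add0r.
have -> : expR (- t) = expR (- (2^-1 * t)) * expR (- (2^-1 * t)).
  by rewrite -expRD; congr expR; field.
rewrite mulrA ler_pM2r ?expR_gt0//.
rewrite expRN ler_pdivrMr ?expR_gt0//.
apply: (@le_trans _ _ (t ^+ m)).
  rewrite -powR_mulrn ?(ltW t0)// ler_powR ?(ltW t1)//.
  by rewrite lerBlDr ltW// (lt_le_trans (truncnS_gt s))// lerDl.
have := @pow_div_fact_le_expR (2^-1 * t) m; rewrite mulr_ge0 ?(ltW t0)// => /(_ erefl).
rewrite ler_pdivrMr ?ltr0n ?fact_gt0// exprMn exprVn ler_pdivrMl ?exprn_gt0//.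
by rewrite /C => h; rewrite (le_trans h)// le_eqVlt; apply/orP; left; apply/eqP; ring.
Qed.

Lemma gammaE_gt0 (s : R) : 0 < s -> (0 < gammaE s)%E.
Proof.
move=> s0; apply: (@lt_le_trans _ _ (\int[mu]_(t in `[1%R, 2%R]) (2^-1 * expR (- 2))%:E)%E).
  rewrite integral_cst//= lebesgue_measure_itv/= lte_fin ltr1n -EFinB -EFinM lte_fin.
  by rewrite mulr_gt0// ?mulr_gt0 ?expR_gt0//; lra.
have mg D : measurable_fun D (fun t : R => (t `^ (s - 1) * expR (- t))%:E).
  apply/measurable_EFinP; have := @measurable_powR_expR (s - 1) 1 D.
  by rewrite (_ : (fun _ => _) = (fun t => t `^ (s - 1) * expR (- t)))//; apply/funext => t; rewrite mul1r.
apply: (@le_trans _ _ (\int[mu]_(t in `[1%R, 2%R]) (t `^ (s - 1) * expR (- t))%:E)%E).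
  apply: ge0_le_integral => //.
  - exact: mg.
  - move=> t; rewrite /= in_itv /= => /andP[t1 t2].
    have t0 : 0 < t by exact: lt_le_trans t1.
    rewrite lee_fin ler_pM ?expR_ge0// ?ler_expR ?lerN2//.
    rewrite (@le_trans _ _ (t `^ (-1)))//.
      by rewrite powR_inv1 ?(ltW t0)// lef_pV2 ?posrE.
    by rewrite ler_powR// lerBrDl subrr ltW.
apply: ge0_subset_integral => //; first exact: mg.
- by move=> t _; rewrite lee_fin mulr_ge0 ?powR_ge0 ?expR_ge0.
- by move=> t; rewrite /= !in_itv /= andbT => /andP[t1 _]; exact: lt_le_trans t1.
Qed.

Lemma gammaE_Gamma (s : R) : 0 < s -> gammaE s = (Gamma s)%:E.
Proof.
move=> s0; rewrite /Gamma /Rintegral fineK// ge0_fin_numE ?gammaE_lty//.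
exact: ltW (gammaE_gt0 s0).
Qed.

Lemma Gamma_gt0 (s : R) : 0 < s -> 0 < Gamma s.
Proof. by move=> s0; rewrite -lte_fin -gammaE_Gamma// gammaE_gt0. Qed.

(** After division by t^(s-1), both powers on the right are bounded below by their tangents in ln t,
    of slopes e and -s/2. The coefficient 2 e / s is the one that cancels the logarithm. *)
Lemma powR_pert (t s e : R) : 0 < t -> 0 < s -> 0 <= e ->
  t `^ (s - 1) <= t `^ (s + e - 1) + 2 * e / s * t `^ (s / 2 - 1).
Proof.
move=> t0 s0 e0.
have -> : s + e - 1 = (s - 1) + e by ring.
have -> : s / 2 - 1 = (s - 1) - s / 2 by field.
rewrite (@powRD _ t (s - 1) e) ?(gt_eqF t0) ?implybT//.
rewrite (@powRD _ t (s - 1) (- (s / 2))) ?(gt_eqF t0) ?implybT// mulrCA -mulrDr ler_peMr ?powR_ge0//.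
have h1 : 1 + e * ln t <= t `^ e by rewrite /powR (gt_eqF t0) expR_ge1Dx.
have h2 : 1 - s / 2 * ln t <= t `^ (- (s / 2)).
  by rewrite /powR (gt_eqF t0) -mulNr expR_ge1Dx.
have h3 : 2 * e / s * (1 - s / 2 * ln t) <= 2 * e / s * t `^ (- (s / 2)).
  by rewrite ler_wpM2l// divr_ge0 ?mulr_ge0// ltW.
have h4 : 2 * e / s * (1 - s / 2 * ln t) = 2 * e / s - e * ln t.
  by field; rewrite gt_eqF.
have h5 : 0 <= 2 * e / s by rewrite divr_ge0 ?mulr_ge0// ltW.
by move: h1 h3 h5; rewrite h4; lra.
Qed.

(** A quantitative substitute for the continuity of Gamma: only an upper bound on 1 / Gamma(s + e)
    for small e is wanted. *)
Lemma Gamma_pert (s e : R) : 0 < s -> 0 <= e ->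
  Gamma s <= Gamma (s + e) + 2 * e / s * Gamma (s / 2).
Proof.
move=> s0 e0; have s2 : 0 < s / 2 by rewrite divr_gt0.
have se : 0 < s + e by rewrite ltr_wpDr.
have c0 : 0 <= 2 * e / s by rewrite divr_ge0 ?mulr_ge0// ltW.
rewrite -lee_fin EFinD EFinM -!gammaE_Gamma//.
have mg r D : measurable_fun D (fun t : R => (t `^ (r - 1) * expR (- t))%:E).
  apply/measurable_EFinP; have := @measurable_powR_expR (r - 1) 1 D.
  by rewrite (_ : (fun _ => _) = (fun t => t `^ (r - 1) * expR (- t)))//; apply/funext => t; rewrite mul1r.
have g0 r t : (0 <= (t `^ (r - 1) * expR (- t) : R)%:E)%E.
  by rewrite lee_fin mulr_ge0 ?powR_ge0 ?expR_ge0.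
have -> : (gammaE (s + e) + (2 * e / s)%:E * gammaE (s / 2) =
    \int[mu]_(t in `]0%R, +oo[) ((t `^ (s + e - 1) * expR (- t))%:E +
       (2 * e / s)%:E * (t `^ (s / 2 - 1) * expR (- t))%:E))%E.
  rewrite ge0_integralD//; last 3 first.
  - exact: mg.
  - by move=> t _; rewrite mule_ge0.
  - by apply: measurable_funeM; exact: mg.
  by rewrite ge0_integralZl//; exact: mg.
apply: ge0_le_integral => //.
- exact: mg.
- by apply: emeasurable_funD; [|apply: measurable_funeM]; exact: mg.
move=> t; rewrite /= in_itv /= andbT => t0.
rewrite -EFinM -EFinD lee_fin mulrA -mulrDl ler_pM2r ?expR_gt0//.
exact: powR_pert.
Qed.

Lemma a_const_gt0 n : (0 < n)%N -> 0 < a_const R n.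
Proof.
move=> n0; rewrite divr_gt0// mulr_gt0// ?powR_gt0 ?mulr_gt0 ?pi_gt0//.
by rewrite Gamma_gt0// divr_gt0// ltr0n.
Qed.

End gamma_function.

(** * The lattice sums *)

Section lattice_sum.
Context {R : realType}.
Notation mu := (@lebesgue_measure R).

Lemma sin_mvt (x : R) : 0 < x -> exists2 c, 0 < c < x & sin x = cos c * x.
Proof.
move=> x0.
have [c] := @MVT R (@sin R) (@cos R) 0 x x0 (fun t _ => is_derive_sin t)
   (continuous_subspaceT (@continuous_sin R)).
by rewrite in_itv /= sin0 !subr0 => cx ->; exists c.
Qed.

Lemma sin_le_id (x : R) : 0 <= x -> sin x <= x.
Proof.
rewrite le_eqVlt => /predU1P[<-|x0]; first by rewrite sin0.
have [c _ ->] := sin_mvt x0; rewrite ger_pMl//; exact: cos_le1.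
Qed.

Lemma sin_ge_mul_cos (x : R) : 0 <= x <= pi / 2 -> x * cos x <= sin x.
Proof.
case/andP; rewrite le_eqVlt => /predU1P[<- _|x0 xpi]; first by rewrite sin0 mul0r.
have [c /andP[c0 cx] ->] := sin_mvt x0; rewrite mulrC ler_pM2r//.
have pi0 := @pi_gt0 R.
have [/eqP->//|cx'] := boolP (c == x).
apply: ltW; rewrite ltr_cos// in_itv /= ltW//=; lra.
Qed.

(** On [0, pi/2] one has x cos x <= sin x, and cos^2 = 1 - sin^2 is at least 1 - (pi e)^2. *)
Lemma sqr_sin_near (e u : R) : 0 < e <= 2^-1 -> `|u| <= e ->
  (1 - (pi * e) ^+ 2) * (pi * u) ^+ 2 <= sin (pi * u) ^+ 2.
Proof.
move=> /andP[e0 e1] ue; have pi0 := @pi_gt0 R.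
wlog u0 : u ue / 0 <= u => [H|].
  have [|/ltW u0] := leP 0 u; first exact: H.
  rewrite -[(pi * u) ^+ 2]sqrrN -[sin _ ^+ 2]sqrrN -sinN -(mulrN pi u).
  by apply: H; rewrite ?normrN ?oppr_ge0.
rewrite ger0_norm// in ue.
have pu0 : 0 <= pi * u by rewrite mulr_ge0// ltW.
have pue : pi * u <= pi * e by rewrite ler_pM2l.
have pe2 : pi * e <= pi / 2 by rewrite ler_pM2l.
have cu : 0 <= cos (pi * u) by apply: cos_ge0_pihalf; lra.
have su : 0 <= sin (pi * u) by apply: sin_ge0_pi; lra.
have h1 : (pi * u * cos (pi * u)) ^+ 2 <= sin (pi * u) ^+ 2.
  rewrite ler_pXn2r ?nnegrE//; last exact: mulr_ge0 pu0 cu.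
  by apply: sin_ge_mul_cos; lra.
apply: le_trans h1; rewrite [leRHS]exprMn [leRHS]mulrC ler_wpM2r ?sqr_ge0//.
rewrite cos2sin2 lerB// ler_pXn2r ?nnegrE//.
- exact: le_trans (sin_le_id pu0) _.
- exact: le_trans pue.
Qed.

Lemma sqr_sin_far (e u : R) : 0 < e -> e <= `|u| <= 2^-1 ->
  sin (pi * e) ^+ 2 <= sin (pi * u) ^+ 2.
Proof.
move=> e0 /andP[eu u2]; have pi0 := @pi_gt0 R.
wlog u0 : u eu u2 / 0 <= u => [H|].
  have [|/ltW u0] := leP 0 u; first exact: H.
  rewrite -[sin (pi * u) ^+ 2]sqrrN -sinN -(mulrN pi u).
  by apply: H; rewrite ?normrN// oppr_ge0.
rewrite ger0_norm// in eu u2.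
have pe0 : 0 < pi * e by rewrite mulr_gt0.
have peu : pi * e <= pi * u by rewrite ler_pM2l.
have pu2 : pi * u <= pi / 2 by rewrite ler_pM2l.
have se0 : 0 <= sin (pi * e) by apply: sin_ge0_pi; lra.
have su0 : 0 <= sin (pi * u) by apply: sin_ge0_pi; lra.
rewrite ler_pXn2r ?nnegrE//.
have [/eqP->//|neq] := boolP (pi * e == pi * u).
by rewrite ltW// ltr_sin ?in_itv /=; lra.
Qed.

Lemma powR_anti (x y s : R) : 0 <= s -> 0 < x -> x <= y -> y `^ (- s) <= x `^ (- s).
Proof.
move=> s0 x0 xy; have y0 := lt_le_trans x0 xy.
rewrite !powRN lef_pV2 ?posrE ?powR_gt0//.
by apply: ge0_ler_powR => //; rewrite nnegrE ltW.
Qed.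

Definition sqnorm n (z : 'rV[int]_n) : R := \sum_(k < n) (z 0 k)%:~R ^+ 2.

Lemma sqnorm_ge1 n (z : 'rV[int]_n) : z != 0 -> 1 <= sqnorm z.
Proof.
move=> z0; have /existsP[k zk] : [exists k, z 0 k != 0].
  apply/contraT; rewrite negb_exists => /forallP z_0; case/eqP: z0.
  by apply/rowP => k; rewrite mxE; apply/eqP; have := z_0 k; rewrite negbK.
rewrite /sqnorm (bigD1 k)//= -[leLHS]addr0 lerD//; last first.
  by apply: sumr_ge0 => i _; exact: sqr_ge0.
rewrite -rmorphXn /= -[1 : R]/(1%:~R) ler_int -gtz0_ge1.
by rewrite exprn_even_gt0.
Qed.

(* The first term covers the [z] with all [|z_k| / L <= e], where [sin] is almost
   linear; for the other ones [lambda L z] is at least of order [L ^+ 2]. *)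
Lemma lambda_powN_le n (L : nat) (e s : R) (z : 'rV[int]_n) : 0 < e <= 2^-1 ->
  0 < 1 - (pi * e) ^+ 2 -> 0 <= s -> (0 < L)%N -> intbox n L z -> z != 0 ->
  lambda R L z `^ (- s) <=
    ((1 - (pi * e) ^+ 2) * (2 * pi) ^+ 2 * sqnorm z) `^ (- s) +
    (4 * L%:R ^+ 2 * sin (pi * e) ^+ 2) `^ (- s).
Proof.
move=> e2 rho0 s0 L0 zL z0; have pi0 := @pi_gt0 R.
have /andP[e0 e12] := e2.
have LR : 0 < L%:R :> R by rewrite ltr0n.
have zle k : `|(z 0 k)%:~R / L%:R| <= 2^-1 :> R.
  rewrite normrM normfV (ger0_norm (ler0n R L)) ler_pdivrMr//.
  rewrite mulrC ler_pdivlMr// -intr_norm -[L%:R]/(L%:Z%:~R) -[2 : R]/(2%:Z%:~R) -intrM ler_int.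
  have : (2 * `|z 0%R k| < L)%N.
    apply: leq_ltn_trans zL; rewrite leq_mul2l /=.
    exact: (@leq_bigmax _ (fun i => `|z 0%R i|%N)).
  by rewrite -ltz_nat PoszM abszE => /ltW; rewrite mulrC.
have sinE k : pi * (z 0 k)%:~R / L%:R = pi * ((z 0 k)%:~R / L%:R) :> R by rewrite mulrA.
have [near|/existsNP[k /negP]] := pselect (forall k, `|(z 0 k)%:~R / L%:R| <= e).
  apply: ler_wpDr; first exact: powR_ge0.
  apply: powR_anti => //.
    rewrite mulr_gt0// ?mulr_gt0 ?exprn_gt0 ?mulr_gt0//.
    exact: lt_le_trans (sqnorm_ge1 z0).
  rewrite /lambda /sqnorm !mulr_sumr; apply: ler_sum => k _.
  rewrite sinE; have h := sqr_sin_near e2 (near k).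
  have c0 : 0 < 4 * L%:R ^+ 2 :> R by rewrite mulr_gt0 ?exprn_gt0.
  rewrite -(ler_pM2l c0) in h.
  apply: le_trans h; rewrite le_eqVlt; apply/orP; left; apply/eqP.
  by field; rewrite gt_eqF.
rewrite -ltNge => far.
apply: ler_wpDl; first exact: powR_ge0.
apply: powR_anti => //.
  rewrite mulr_gt0 ?exprn_gt0 ?mulr_gt0 ?exprn_gt0//.
  by rewrite sin_gt0_pi// mulr_gt0//= gtr_pMr//; lra.
rewrite /lambda ler_pM2l ?mulr_gt0 ?exprn_gt0//.
rewrite (bigD1 k)//= ler_wpDr//; first by apply: sumr_ge0 => i _; exact: sqr_ge0.
by rewrite sinE; apply: sqr_sin_far => //; rewrite ltW//=; exact: zle.
Qed.

Section box.
Variables (n M : nat).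
Let L := M.*2.+1.

(** Centring the digits 0, ..., 2M at M indexes the cube [-M, M]^n by functions on coordinates, so
    that Gaussian sums over it factor into one-dimensional ones. *)
Definition box_point (w : {ffun 'I_n -> 'I_L}) : 'rV[int]_n :=
  \row_k ((w k : nat)%:Z - M%:Z).

Lemma box_point_inj : injective box_point.
Proof.
move=> w w' /rowP E; apply/ffunP => k; have := E k; rewrite !mxE => /addIr [].
exact: val_inj.
Qed.

Lemma intboxE : intbox n L = range box_point.
Proof.
have maxP (z : 'rV[int]_n) : intbox n L z <-> forall k, (`|z 0%R k| <= M)%N.
  rewrite /intbox /= /L ltnS mul2n leq_double; split.
    by move=> /bigmax_leqP H k; exact: H.
  by move=> H; apply/bigmax_leqP.
apply/seteqP; split => [z /maxP zM|_ [w _ <-]]; last first.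
  apply/maxP => k; rewrite mxE; have wL : (w k < M.*2.+1)%N := ltn_ord (w k); lia.
exists [ffun k => inord `|z 0%R k + M%:Z|] => //.
apply/rowP => k; rewrite mxE ffunE inordK; last by have := zM k; rewrite -addnn; lia.
by have := zM k; lia.
Qed.

Lemma sum_intbox (F : 'rV[int]_n -> R) :
  \sum_(z \in intbox n L `\ 0) F z = \sum_(w | box_point w != 0) F (box_point w).
Proof.
have -> : intbox n L `\ 0 = box_point @` [set` [seq w <- enum {ffun 'I_n -> 'I_L} | box_point w != 0]].
  rewrite intboxE; apply/seteqP; split => [z [[w _ <-] w0]|_ [w /= + <-]].
    by exists w => //=; rewrite mem_filter mem_enum andbT; apply/eqP.
  by rewrite mem_filter => /andP[w0 _]; split; [exists w|exact/eqP].
rewrite fsbig_image; last by move=> w w' _ _; exact: box_point_inj.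
transitivity (\sum_(w <- [seq w <- enum {ffun 'I_n -> 'I_L} | box_point w != 0]) F (box_point w)).
  by symmetry; apply: fsbig_seq; rewrite filter_uniq ?enum_uniq.
by rewrite big_filter big_enum_cond.
Qed.

End box.

Lemma integral_exp_sqr (t : R) : 0 < t ->
  (\int[mu]_(x in `[0%R, +oo[) (expR (- (t * x ^+ 2)))%:E = (Num.sqrt (pi / t) / 2)%:E)%E.
Proof.
move=> t0; have st0 : 0 < Num.sqrt t by rewrite sqrtr_gt0.
pose g (x : R) : R := (gauss_fun \_ `[0, +oo[%classic) x.
have g0 x : 0 <= g x by rewrite /g /patch; case: ifP => // _; exact: gauss_fun_ge0.
have mg : measurable_fun setT g.
  apply: (measurable_restrictT _ _).1 => //; apply: measurable_funTS; exact: measurable_gauss_fun.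
have /(congr1 (fun x => (Num.sqrt t)^-1%:E * x)%E) := ge0_integral_scale st0 mg g0.
rewrite muleA -EFinM mulVf ?gt_eqF// mul1e.
have -> : (\int[mu]_x (g x)%:E = (Num.sqrt pi / 2)%:E)%E.
  rewrite -integral0y_gauss [RHS]integral_mkcond; apply: eq_integral => x _.
  by rewrite /g /patch; case: ifP.
move=> E; transitivity (\int[mu]_x (g (Num.sqrt t * x))%:E)%E.
  rewrite integral_mkcond; apply: eq_integral => x _.
  rewrite /g /patch !mem_setE !in_itv /= !andbT pmulr_rge0//; case: ifP => // _.
  by rewrite /gauss_fun exprMn sqr_sqrtr// ltW.
rewrite -E -EFinM; congr EFin.
by rewrite sqrtrM ?pi_ge0// sqrtrV ?ltW//; field; rewrite gt_eqF.
Qed.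

(** Integral test for a decreasing function, one unit interval at a time. *)
Lemma sum_exp_sqr_le (t : R) M : 0 < t ->
  \sum_(1 <= k < M.+1) expR (- (t * k%:R ^+ 2)) <= Num.sqrt (pi / t) / 2.
Proof.
move=> t0; rewrite -lee_fin -integral_exp_sqr//.
have mf D : measurable_fun D (fun x : R => (expR (- (t * x ^+ 2)))%:E).
  apply: measurable_funTS; apply/measurable_EFinP; apply: measurableT_comp => //.
  by apply: measurableT_comp => //; apply: measurable_funM => //; exact: measurable_funX.
apply: (@le_trans _ _ (\int[mu]_(x in `[0%R, M%:R[) (expR (- (t * x ^+ 2)))%:E)%E); last first.
  apply: ge0_subset_integral => //; first exact: mf.
  by move=> x; rewrite /= !in_itv /= andbT => /andP[].
elim: M => [|M IH].
  by rewrite big_geq// integral_ge0// => x _; rewrite lee_fin expR_ge0.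
rewrite big_nat_recr//= EFinD.
have -> : `[0%R, M.+1%:R[%classic = `[0%R, M%:R[ `|` `[M%:R, M.+1%:R[%classic :> set R.
  apply/seteqP; split => x /=; rewrite !in_itv /=.
    by case: (ltP x M%:R) => xM /andP[x0 x1]; [left; rewrite x0|right; rewrite x1].
  case=> /andP[x0 x1]; first by rewrite x0 (lt_le_trans x1)// ler_nat.
  by rewrite x1 (le_trans _ x0).
rewrite ge0_integral_setU//=; do ?exact: mf; first last.
- rewrite disj_set2E; apply/eqP/seteqP; split => x //= [].
  by rewrite !in_itv /= => /andP[_ x1] /andP[]; rewrite leNgt x1.
apply: leeD => //.
apply: (@le_trans _ _ (\int[mu]_(x in `[M%:R, M.+1%:R[) (expR (- (t * M.+1%:R ^+ 2)))%:E)%E).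
  rewrite integral_cst//= lebesgue_measure_itv /= lte_fin ltr_nat ltnSn -EFinB -EFinM lee_fin.
  by rewrite -natrB// subSnn mulr1.
apply: ge0_le_integral => //; first exact: mf.
move=> x; rewrite /= in_itv /= => /andP[x0 x1].
have xp : 0 <= x by apply: le_trans x0.
by rewrite lee_fin ler_expR lerN2 ler_pM2l// ler_pXn2r ?nnegrE// ltW.
Qed.

Lemma theta_le (t : R) M : 0 < t ->
  \sum_(i < M.*2.+1) expR (- (t * ((i : nat)%:Z - M%:Z)%:~R ^+ 2)) <= 1 + Num.sqrt (pi / t).
Proof.
move=> t0; pose h k := expR (- (t * k%:R ^+ 2)) : R.
rewrite -(big_mkord xpredT (fun i => expR (- (t * (i%:Z - M%:Z)%:~R ^+ 2)))).
rewrite (@big_cat_nat _ _ _ M)//=; last by rewrite -addnn; lia.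
rewrite (@big_ltn _ _ _ M); last by rewrite -addnn; lia.
rewrite subrr expr0n mulr0 oppr0 expR0.
have S1 : \sum_(0 <= i < M) expR (- (t * (i%:Z - M%:Z)%:~R ^+ 2)) = \sum_(1 <= k < M.+1) h k.
  rewrite big_nat_rev /= big_add1 /=; apply: eq_big_nat => i /andP[_ iM].
  rewrite add0n /h; congr (expR (- (t * _))).
  have -> : ((M - i.+1)%N%:Z - M%:Z = - i.+1%:Z)%R by lia.
  by rewrite intrN sqrrN -pmulrn.
have S2 : \sum_(M.+1 <= i < M.*2.+1) expR (- (t * (i%:Z - M%:Z)%:~R ^+ 2)) = \sum_(1 <= k < M.+1) h k.
  rewrite -[M.+1 in LHS]add1n big_addn (_ : (M.*2.+1 - M = M.+1)%N); last by rewrite -addnn; lia.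
  by apply: eq_bigr => i _; rewrite /h PoszD addrK.
have := sum_exp_sqr_le M t0; rewrite S1 S2 /h; lra.
Qed.

Lemma sqnorm_ge0 n (z : 'rV[int]_n) : 0 <= sqnorm z.
Proof. by apply: sumr_ge0 => k _; exact: sqr_ge0. Qed.

Lemma sum_box_exp_le (t : R) n M : 0 < t ->
  \sum_(w | box_point w != 0) expR (- (t * sqnorm (@box_point n M w))) <=
  (1 + Num.sqrt (pi / t)) ^+ n.
Proof.
move=> t0.
apply: (@le_trans _ _ (\sum_(w : {ffun 'I_n -> 'I_M.*2.+1}) expR (- (t * sqnorm (box_point w))))).
  rewrite [leRHS](bigID (fun w => box_point w != 0))/= lerDl.
  by apply: sumr_ge0 => w _; exact: expR_ge0.
under eq_bigr => w _.
  rewrite /sqnorm mulr_sumr -sumrN expR_sum.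
  under eq_bigr do rewrite mxE.
  over.
rewrite -(bigA_distr_bigA (fun (k : 'I_n) (i : 'I_M.*2.+1) =>
   expR (- (t * ((i : nat)%:Z - M%:Z)%:~R ^+ 2)))) /=.
rewrite prodr_const card_ord; apply: lerXn2r; rewrite ?nnegrE.
- by apply: sumr_ge0 => i _; exact: expR_ge0.
- by rewrite addr_ge0// sqrtr_ge0.
- exact: theta_le.
Qed.

(** Either u <= 1/eta, or 1 < eta u and hence 1 + u <= (1 + eta) u. The leading coefficient stays as
    close to 1 as desired, while the lower powers of u are merged into a constant. *)
Lemma exprD1_le (u eta : R) n : 0 <= u -> 0 < eta ->
  (1 + u) ^+ n <= (1 + eta) ^+ n * u ^+ n + (1 + eta^-1) ^+ n.
Proof.
move=> u0 eta0; have ei : 0 < eta^-1 by rewrite invr_gt0.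
have e0 := ltW eta0; have e1 := ltW ei.
have [ue|ue] := leP u eta^-1.
  apply: ler_wpDl; first by rewrite mulr_ge0 ?exprn_ge0 ?addr_ge0.
  by apply: lerXn2r; rewrite ?nnegrE ?addr_ge0 ?lerD2l.
apply: ler_wpDr; first by rewrite exprn_ge0 ?addr_ge0.
rewrite -exprMn; apply: lerXn2r; rewrite ?nnegrE ?addr_ge0 ?mulr_ge0 ?addr_ge0//.
by rewrite mulrDl mul1r addrC lerD2l -(mulfV (lt0r_neq0 eta0)) ler_pM2l// ltW.
Qed.

(* [Gamma s * q `^ (- s)] is the integral of [t `^ (s - 1) * expR (- q t)]; the
   first two terms come from [t <= 1], the third one from [t > 1]. *)
Lemma lattice_sum_le n M (s eta : R) : (0 < n)%N -> n%:R / 2 < s -> 0 < eta ->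
  Gamma s * \sum_(w | box_point w != 0) sqnorm (@box_point n M w) `^ (- s) <=
  (1 + eta) ^+ n * pi `^ (n%:R / 2) / (s - n%:R / 2) + (1 + eta^-1) ^+ n / s +
  expR 1 * (1 + Num.sqrt pi) ^+ n * Gamma s.
Proof.
move=> n0 ns eta0.
have n2 : 0 < n%:R / 2 :> R by rewrite divr_gt0 ?ltr0n.
have s0 : 0 < s by exact: lt_trans ns.
rewrite -lee_fin EFinM EFinD [X in (_ <= _ + X)%E]EFinM -gammaE_Gamma//.
rewrite -sumEFin ge0_sume_distrr; last by move=> w _; rewrite lee_fin powR_ge0.
have q1 (w : {ffun 'I_n -> 'I_M.*2.+1}) : box_point w != 0 -> 1 <= sqnorm (box_point w).
  exact: sqnorm_ge1.
pose f (t : R) : R := \sum_(w | box_point w != 0)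
  (t `^ (s - 1) * expR (- (sqnorm (@box_point n M w) * t))).
have -> : (\sum_(w | box_point w != 0%R) ((\int[mu]_(t in `]0%R, +oo[) (t `^ (s - 1) * expR (- t))%:E) *
     (sqnorm (@box_point n M w) `^ (- s))%:E) = \int[mu]_(t in `]0%R, +oo[) (f t)%:E)%E.
  rewrite /f -big_filter.
  under [RHS]eq_integral do rewrite -big_filter -sumEFin.
  rewrite ge0_integral_sum//; last 2 first.
  - by move=> w; apply/measurable_EFinP; exact: measurable_powR_expR.
  - by move=> w t _; rewrite lee_fin mulr_ge0 ?powR_ge0 ?expR_ge0.
  rewrite !big_filter; apply: eq_bigr => w /q1 qw.
  rewrite muleC; apply: esym.
  exact: (integral_powR_expR s (lt_le_trans ltr01 qw)).
have -> : expR 1 * (1 + Num.sqrt pi) ^+ n = expR 1 * (1 + Num.sqrt pi) ^+ n * 1 `^ (- s) :> R.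
  by rewrite powR1 mulr1.
apply: integral_gamma_type_le => //.
- by rewrite mulr_ge0 ?exprn_ge0 ?powR_ge0// addr_ge0// ltW.
- by rewrite exprn_ge0// addr_ge0// invr_ge0 ltW.
- by rewrite subr_gt0.
- rewrite /f; under eq_fun do rewrite -big_filter.
  by apply: measurable_sum => w; exact: measurable_powR_expR.
- by move=> t _; apply: sumr_ge0 => w _; rewrite mulr_ge0 ?powR_ge0 ?expR_ge0.
move=> t t0; rewrite /f -mulr_sumr indicE mem_setE in_itv /= t0 /=.
have pi0 := @pi_gt0 R.
have [t1|t1] := leP t 1.
  rewrite -[true%:R]/(1 : R) !mul1r; apply: ler_wpDr.
    by rewrite !mulr_ge0 ?powR_ge0 ?expR_ge0 ?exprn_ge0// addr_ge0 ?sqrtr_ge0.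
  apply: (@le_trans _ _ (t `^ (s - 1) * ((1 + eta) ^+ n * Num.sqrt (pi / t) ^+ n + (1 + eta^-1) ^+ n))).
    rewrite ler_wpM2l ?powR_ge0//; apply: le_trans (exprD1_le n (sqrtr_ge0 _) eta0).
    rewrite (eq_bigr (fun w => expR (- (t * sqnorm (@box_point n M w))))) => [|w _]; last by rewrite mulrC.
    exact: sum_box_exp_le.
  have -> : Num.sqrt (pi / t) ^+ n = pi `^ (n%:R / 2) * t `^ (- (n%:R / 2)).
    rewrite -powR12_sqrt ?divr_ge0 ?ltW// -powR_mulrn ?powR_ge0// -powRrM [2^-1 * _]mulrC.
    rewrite powRM ?invr_ge0 ?ltW//.
    by rewrite -[t^-1]powR_inv1 ?(ltW t0)// -powRrM mulN1r.
  rewrite (_ : s - n%:R / 2 - 1 = (s - 1) - n%:R / 2); last by ring.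
  rewrite (@powRD _ t (s - 1) (- (n%:R / 2))) ?(gt_eqF t0) ?implybT//.
  by rewrite le_eqVlt; apply/orP; left; apply/eqP; ring.
rewrite mul0r add0r mul1r mulrCA ler_wpM2l ?powR_ge0//.
(* For t > 1 and q >= 1, (t - 1)(q - 1) >= 0 gives exp(-q t) <= exp(1) exp(-t) exp(-q), which
   separates t from the lattice point. *)
apply: (@le_trans _ _ (\sum_(w | box_point w != 0)
    expR 1 * expR (- t) * expR (- (1 * sqnorm (@box_point n M w))))).
  apply: ler_sum => w /q1 qw; rewrite -!expRD ler_expR mul1r.
  have : 0 <= (t - 1) * (sqnorm (box_point w) - 1) by rewrite mulr_ge0 ?subr_ge0// ltW.
  lra.
rewrite -mulr_sumr -!mulrA ler_wpM2l ?expR_ge0// [leRHS]mulrC.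
rewrite ler_wpM2l ?expR_ge0//.
by have := @sum_box_exp_le 1 n M ltr01; rewrite divr1.
Qed.

End lattice_sum.

(** * Power sums of the discrete eigenvalues, with the sharp slope *)

Section lambda_sum.
Local Opaque Gamma.
Context {R : realType}.

(** On the left, the factor (4 pi)^(n/2) of 1 / a_n and the pi^(n/2) of the theta bound; on the
    right, the (2 pi)^n from the comparison of lambda_z with (2 pi)^2 |z|^2. *)
Lemma pi_powR_identity n :
  (4 * pi : R) `^ (n%:R / 2) * pi `^ (n%:R / 2) = ((2 * pi) ^+ 2) `^ (n%:R / 2).
Proof.
have pi0 := @pi_ge0 R.
rewrite -powRM ?mulr_ge0//; congr (_ `^ _); ring.
Qed.

(** The exponent s exceeds n/2 by n / (2 (j+1)), so the pole of the lattice sum contributes 2 (j+1)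
    / n. The remaining leading factors multiply to 1/2 by the choice of a_n, up to a loss of r. [C]
    and [J] are chosen before the size of the box. *)
Lemma lambda_sum_le n (r : R) : (0 < n)%N -> 1 < r <= 2 ->
  exists C J, 0 <= C /\ forall M j, (J <= j)%N ->
  (a_const R n)^-1 * \sum_(z \in intbox n M.*2.+1 `\ 0)
      lambda R M.*2.+1 z `^ (- (n%:R / 2 * (j.+2%:R / j.+1%:R))) <=
    r * (j.+1%:R / n%:R) + C.
Proof.
move=> n0 /andP[r1 r2]; have pi0 := @pi_gt0 R.
have nR : 0 < n%:R :> R by rewrite ltr0n.
have n2 : 0 < n%:R / 2 :> R by rewrite divr_gt0.
have r0 : 0 < r by exact: lt_trans r1.
(* Each of the [2 n + 1] approximations below costs a factor [q]. *)
pose q : R := r `^ (n.*2.+1%:R^-1); pose eta := q - 1.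
have qE : q ^+ n.*2.+1 = r.
  by rewrite -powR_mulrn ?powR_ge0// -powRrM mulVf ?pnatr_eq0// powRr1// ltW.
have q0 : 0 < q by rewrite powR_gt0.
have q1 : 1 < q.
  rewrite ltNge; apply/negP => q1; move: r1; rewrite -qE ltNge exprn_ile1//.
  exact: ltW.
have q2 : q <= 2.
  apply: le_trans r2; apply: ler1_powR; first exact: ltW.
  by rewrite invf_le1 ?ltr0n// ler1n.
have eta0 : 0 < eta by rewrite subr_gt0.
have etaE : 1 + eta = q by rewrite /eta addrC subrK.
clearbody eta; clearbody q.
(* Absorption of an error: if x <= y + v and v is at most eta x / q, then passing from y + v to y
   costs the factor q = 1 + eta. *)
have gen (x y v : R) : v * q <= eta * x -> x * q <= (y + v) * q -> x <= q * y.
  by rewrite -etaE; lra.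
(* [rho] enters to the power -n/2 and so costs q^n. The threshold [e] between near and far
   frequencies is then the solution of 1 - (pi e)^2 = rho. *)
pose rho := q ^- 2.
have rho0 : 0 < rho by rewrite invr_gt0 exprn_gt0.
have rho1 : rho < 1 by rewrite invf_lt1 ?exprn_gt0// exprn_egt1.
pose e := Num.sqrt (1 - rho) / pi.
have pieE : pi * e = Num.sqrt (1 - rho) by rewrite /e mulrC divfK// gt_eqF.
have pie2 : (pi * e) ^+ 2 = 1 - rho by rewrite pieE sqr_sqrtr// subr_ge0 ltW.
have pie1 : pi * e < 1.
  by rewrite pieE -[ltRHS]sqrtr1 ltr_sqrt// ltrBlDr ltrDl.
have pi2 := @pi_ge2 R.
have e12 : 0 < e <= 2^-1.
  have e0 : 0 < e by rewrite divr_gt0// sqrtr_gt0 subr_gt0.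
  rewrite e0 /=.
  have : 2 * e <= pi * e by rewrite ler_pM2r.
  by move: pie1; lra.
have e0 : 0 < e by case/andP: e12.
have rhoE : 1 - (pi * e) ^+ 2 = rho by rewrite pie2; ring.
have rhoq : rho = q ^- 2 by [].
clearbody e; clearbody rho.
pose K := rho * (2 * pi) ^+ 2.
(* This allows the exponent -s on [K] to be replaced by -n/2; it holds because q <= 2 <= 2 pi. *)
have K1 : 1 <= K.
  rewrite /K rhoq ler_pdivlMl ?exprn_gt0// mulr1.
  by apply: lerXn2r; rewrite ?nnegrE ?mulr_ge0 ?ltW//; move: q2 pi2; lra.
pose c := sin (pi * e) ^+ 2.
have sinpie : 0 < sin (pi * e) by rewrite sin_gt0_pi// mulr_gt0//=; move: pie1 pi2; lra.
have c0 : 0 < c by rewrite exprn_gt0.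
have c1 : c <= 1 by rewrite exprn_ile1 ?sin_le1// ltW.
have G0 : 0 < Gamma (n%:R / 2 : R) by rewrite Gamma_gt0.
pose G4 : R := Gamma (n%:R / 2 / 2).
have G40 : 0 < G4 by rewrite Gamma_gt0// divr_gt0.
pose A1 := q ^+ n * pi `^ (n%:R / 2).
pose B := (1 + eta^-1) ^+ n.
have B0 : 0 <= B by rewrite exprn_ge0// addr_ge0// invr_ge0 ltW.
pose E : R := expR 1 * (1 + Num.sqrt pi) ^+ n.
have E0 : 0 <= E by rewrite mulr_ge0 ?expR_ge0// exprn_ge0// addr_ge0// sqrtr_ge0.
have a0 := @a_const_gt0 R n n0.
have ai0 : 0 <= (a_const R n)^-1 by rewrite invr_ge0 ltW.
(* All contributions without the factor j + 1; the last summand comes from the far frequencies. *)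
exists ((a_const R n)^-1 *
  (K `^ (- (n%:R / 2)) * (q / Gamma (n%:R / 2) * (2 * B) + E) + c `^ (- n%:R))).
(* From this index on, the error in passing from Gamma s to Gamma(n/2) is small enough to cost only
   the factor q. *)
exists (Num.truncn (2 * G4 * q / (eta * Gamma (n%:R / 2)))).
split.
  rewrite mulr_ge0// addr_ge0 ?powR_ge0// mulr_ge0 ?powR_ge0// addr_ge0//.
  exact: mulr_ge0 (ltW (divr_gt0 q0 G0)) (mulr_ge0 (ler0n _ _) B0).
move=> M j Jj; pose L := M.*2.+1; pose s : R := n%:R / 2 * (j.+2%:R / j.+1%:R).
have j1 : 0 < j.+1%:R :> R by rewrite ltr0n.
have sE : s = n%:R / 2 + n%:R / 2 / j.+1%:R.
  by rewrite /s -[j.+2]addn1 natrD; field; rewrite gt_eqF.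
have sd : 0 < n%:R / 2 / j.+1%:R :> R by rewrite divr_gt0.
have sn2 : n%:R / 2 < s by rewrite sE ltrDl.
have s0 : 0 < s by exact: lt_trans sn2.
have sn : s <= n%:R.
  rewrite sE [leRHS](_ : _ = n%:R / 2 + n%:R / 2); last by field.
  by rewrite lerD2l ler_pdivrMr// ler_peMr ?(ltW n2)// ler1n.
have s2 : 2^-1 <= s.
  apply: le_trans (ltW sn2); rewrite ler_pdivlMr// mulVf// ler1n//.
have Gs0 : 0 < Gamma s by rewrite Gamma_gt0.
have Gle : (Gamma s)^-1 <= q / Gamma (n%:R / 2).
  rewrite -[leLHS]mul1r (ler_pdivrMr _ _ Gs0) mulrAC (ler_pdivlMr _ _ G0) mul1r.
  have := @Gamma_pert R _ _ n2 (ltW sd); rewrite -sE -/G4.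
  have -> : 2 * (n%:R / 2 / j.+1%:R) / (n%:R / 2) = 2 / j.+1%:R :> R.
    by field; rewrite !gt_eqF.
  have : 2 * G4 * q / (eta * Gamma (n%:R / 2)) <= j.+1%:R.
    by rewrite ltW// (lt_le_trans (truncnS_gt _))// ler_nat ltnS.
  rewrite (ler_pdivrMr _ _ (mulr_gt0 eta0 G0)) => h1 h2.
  have h3 : 2 / j.+1%:R * G4 * q <= eta * Gamma (n%:R / 2).
    rewrite (_ : _ * q = 2 * G4 * q / j.+1%:R); last by ring.
    by rewrite (ler_pdivrMr _ _ j1) [leRHS]mulrC.
  have h4 : Gamma (n%:R / 2) * q <= (Gamma s + 2 / j.+1%:R * G4) * q by rewrite ler_pM2r.
  exact: gen h3 h4.
have L0 : (0 < L)%N by [].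
have LR : 0 < L%:R :> R by rewrite ltr0n.
rewrite -/s -/L (@sum_intbox R n M).
set Sq := \sum_(w | box_point w != 0) sqnorm (@box_point n M w) `^ (- s).
have Sq_le : Sq <= q / Gamma (n%:R / 2) * (A1 * (2 * j.+1%:R / n%:R) + 2 * B) + E.
  have := @lattice_sum_le R n M s eta n0 sn2 eta0; rewrite -/Sq etaE -/A1 -/B -/E.
  rewrite [s - _](_ : _ = n%:R / 2 / j.+1%:R); last by rewrite sE; ring.
  rewrite mulrC -ler_pdivlMr// mulrDl mulfK ?gt_eqF// => h.
  apply: le_trans h _; rewrite lerD2r mulrC.
  have X0 : 0 <= A1 * (2 * j.+1%:R / n%:R) + 2 * B.
    have A10 : 0 <= A1 by rewrite mulr_ge0 ?powR_ge0// exprn_ge0// ltW.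
    by apply: addr_ge0; apply: mulr_ge0 => //; rewrite divr_ge0// mulr_ge0.
  apply: (@le_trans _ _ ((Gamma s)^-1 * (A1 * (2 * j.+1%:R / n%:R) + 2 * B))); last by rewrite ler_wpM2r.
  rewrite ler_pM2l ?invr_gt0// lerD//.
    by rewrite le_eqVlt; apply/orP; left; apply/eqP; field; rewrite !gt_eqF.
  rewrite mulrC ler_wpM2r//.
  by rewrite -[leRHS]invrK lef_pV2 ?posrE ?invr_gt0.
have sum_le : \sum_(w | box_point w != 0) lambda R L (@box_point n M w) `^ (- s) <=
    K `^ (- (n%:R / 2)) * Sq + c `^ (- n%:R).
  (* As n/2 < s <= n and c <= 1, each far contribution is at most L^-n c^-n. The cube has L^n
     points, so their total is bounded uniformly in L. *)
  apply: (@le_trans _ _ (\sum_(w | box_point w != 0)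
     (K `^ (- (n%:R / 2)) * sqnorm (@box_point n M w) `^ (- s) + L%:R ^- n * c `^ (- n%:R)))).
    apply: ler_sum => w w0.
    have wL : intbox n L (box_point w) by rewrite /L intboxE; exists w.
    have rho0' : 0 < 1 - (pi * e) ^+ 2 by rewrite rhoE.
    apply: le_trans (lambda_powN_le e12 rho0' (ltW s0) L0 wL w0) _.
    rewrite rhoE -/K; apply: lerD.
      rewrite powRM ?sqnorm_ge0 ?(le_trans ler01)//.
      by rewrite ler_wpM2r ?powR_ge0// ler_powR// lerN2 ltW.
    apply: (@le_trans _ _ ((L%:R ^+ 2 * c) `^ (- s))).
      apply: powR_anti; [exact: ltW|by rewrite mulr_gt0 ?exprn_gt0|].
      by rewrite ler_pM2r// ler_peMl ?exprn_ge0 ?ler1n// ltW.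
    rewrite powRM; [|exact: exprn_ge0 (ltW LR)|exact: ltW].
    apply: ler_pM; rewrite ?powR_ge0//.
      apply: (@le_trans _ _ ((L%:R ^+ 2) `^ (- (n%:R / 2)))).
        by rewrite ler_powR ?lerN2 ?(ltW sn2)// exprn_ege1// ler1n.
      rewrite powRN -powR_mulrn ?(ltW LR)// -powRrM mulrC divfK ?pnatr_eq0//.
      by rewrite powR_mulrn ?(ltW LR).
    by apply: ger_powR; rewrite ?c0 ?c1// lerN2.
  rewrite big_split /= -mulr_sumr lerD2l.
  apply: (@le_trans _ _ (\sum_(w : {ffun 'I_n -> 'I_L}) L%:R ^- n * c `^ (- n%:R))).
    rewrite [leRHS](bigID (fun w => box_point w != 0))/= lerDl.
    by apply: sumr_ge0 => w _; rewrite mulr_ge0 ?powR_ge0// invr_ge0 exprn_ge0 ?(ltW LR).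
  rewrite sumr_const card_ffun !card_ord -[leLHS]mulr_natl natrX mulrA mulfV ?mul1r//.
  by rewrite expf_neq0// gt_eqF.
have Kp : 0 <= K `^ (- (n%:R / 2)) by rewrite powR_ge0.
have total : (a_const R n)^-1 * \sum_(w | box_point w != 0) lambda R L (@box_point n M w) `^ (- s)
   <= (a_const R n)^-1 * (K `^ (- (n%:R / 2)) *
        (q / Gamma (n%:R / 2) * (A1 * (2 * j.+1%:R / n%:R) + 2 * B) + E) + c `^ (- n%:R)).
  by rewrite ler_wpM2l// (le_trans sum_le)// lerD2r ler_wpM2l.
apply: le_trans total _.
rewrite -lerBlDr le_eqVlt; apply/orP; left; apply/eqP.
transitivity ((a_const R n)^-1 * K `^ (- (n%:R / 2)) *
    (q / Gamma (n%:R / 2)) * A1 * (2 * (j.+1%:R / n%:R))).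
  by ring.
have KE : K `^ (- (n%:R / 2)) = q ^+ n * (((2 * pi) ^+ 2) `^ (n%:R / 2))^-1.
  rewrite /K powRM ?exprn_ge0 ?mulr_ge0 ?ltW// [X in _ * X]powRN; congr (_ * _).
  rewrite rhoq -[q ^- 2]powR_inv1 ?exprn_ge0 ?ltW// -powRrM mulN1r opprK.
  by rewrite -powR_mulrn ?ltW// -powRrM mulrC divfK ?pnatr_eq0// powR_mulrn ?ltW.
rewrite KE -pi_powR_identity /a_const /A1 -[in RHS]qE.
have -> : q ^+ n.*2.+1 = q * q ^+ n * q ^+ n by rewrite exprS -addnn exprD mulrA.
field; rewrite !gt_eqF ?powR_gt0 ?mulr_gt0//.
Qed.

End lambda_sum.

(** * Moments of the covariance kernel *)

Section covariance_moments.
Context {R : realType}.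
Variables (n M : nat).
Hypothesis n0 : (0 < n)%N.
Notation L := M.*2.+1.
Let I := fset_set (intbox n L `\ 0).
Let f (v : I) : R := (a_const R n)^-1 * lambda R L (val v) `^ (- (n%:R / 2)).

Let memI (v : I) : intbox n L (val v) /\ val v != 0.
Proof.
have := valP v; rewrite in_fset_set; last exact: finite_intbox0.
by move=> /set_mem[vL v0]; split => //; exact/eqP.
Qed.

Let f0 v : 0 <= f v.
Proof. by rewrite mulr_ge0 ?powR_ge0// invr_ge0 ltW// a_const_gt0. Qed.

Let covE x y : fourier_cov L x y =
  \sum_(v : I) f v * cos (2 * pi * zdot (val v) (fun k => tnth x k - tnth y k)).
Proof.
rewrite /fourier_cov fsbig_finite/=; last exact: finite_intbox0.
by rewrite big_seq_fsetE /= mulr_sumr; apply: eq_bigr => v _; rewrite mulrA.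
Qed.

(** The box and the coefficients are invariant under z -> -z while the sine is odd. This is the
    hypothesis under which powers of the kernel expand. *)
Let sin_sum0 (u : 'I_n -> R) : \sum_(v : I) f v * sin (2 * pi * zdot (val v) u) = 0.
Proof.
pose F z : R := (a_const R n)^-1 * lambda R L z `^ (- (n%:R / 2)) * sin (2 * pi * zdot z u).
have -> : \sum_(v : I) f v * sin (2 * pi * zdot (val v) u) = \sum_(z \in intbox n L `\ 0) F z.
  by rewrite fsbig_finite/=; [rewrite big_seq_fsetE|exact: finite_intbox0].
suff : \sum_(z \in intbox n L `\ 0) F z = - \sum_(z \in intbox n L `\ 0) F z by lra.
rewrite -{1}fsbig_intbox0N !fsbig_finite/=; do ?exact: finite_intbox0.
by rewrite -sumrN; apply: eq_bigr => z _; rewrite /F lambdaN zdotN mulrN sinN mulrN.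
Qed.

Let Z j (w : {ffun 'I_j -> I}) : 'rV[int]_n := \sum_l val (w l).

Let zdot_sum j (w : {ffun 'I_j -> I}) (u : 'I_n -> R) :
  \sum_l 2 * pi * zdot (val (w l)) u = 2 * pi * zdot (Z w) u.
Proof.
rewrite -mulr_sumr; congr (_ * _); rewrite /zdot exchange_big; apply: eq_bigr => k _.
by rewrite -mulr_suml summxE rmorph_sum.
Qed.

(** The tuples that may resonate on the grid. On the torus only vanishing sums do, and these are
    among them, so one count serves both measures. *)
Let ok j (w : {ffun 'I_j -> I}) := [forall k, (L%:Z %| Z w 0%R k)%Z].

(** Two entries of [-M, M] that are congruent modulo 2M + 1 are equal, since they differ by at most
    2M. *)
Let ok_inj j i (w w' : {ffun 'I_j -> I}) :
  ok w -> ok w' -> (forall l, l != i -> w l = w' l) -> w = w'.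
Proof.
move=> /forallP okw /forallP okw' ww'.
suff E : w i = w' i by apply/ffunP => l; have [->|/ww'] := eqVneq l i.
apply: val_inj; apply/rowP => k /=.
have ZB : Z w - Z w' = val (w i) - val (w' i).
  rewrite /Z (bigD1 i)//= [X in _ - X](bigD1 i)//=.
  rewrite (eq_bigr (fun l => val (w' l))) => [|l /ww' ->//].
  by rewrite opprD addrACA subrr addr0.
have d : (L%:Z %| val (w i) 0%R k - val (w' i) 0%R k)%Z.
  have := rpredB (okw k) (okw' k).
  by have /rowP/(_ k) := ZB; rewrite !mxE => ->.
have bound (v : I) : (`|val v 0%R k| <= M)%N.
  have [+ _] := memI v; rewrite /intbox /= ltnS mul2n leq_double => /bigmax_leqP.
  exact.
have := bound (w i); have := bound (w' i).
case/dvdzP : d => q; set a := val (w i) 0 k; set b := val (w' i) 0 k => qE aM bM.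
have [q0|q0] := eqVneq q 0; first by apply/eqP; rewrite -subr_eq0 qE q0 mul0r.
have : (L <= `|(q * L%:Z)%R|)%N by rewrite abszM leq_pmull// absz_gt0.
rewrite -qE; move: aM bM; clear; lia.
Qed.

Variables (m : {measure set (n.-tuple R) -> \bar R}) (A : set (n.-tuple R)).
Hypothesis mA : measurable A.
Hypothesis mA1 : m A = 1%E.
Hypothesis hosc : forall (z : 'rV[int]_n) (c : R), ~ (forall k, (L%:Z %| z 0%R k)%Z) ->
  (\int[m]_(y in A) (1 + cos (2 * pi * zdot z (tnth y) + c))%:E = 1)%E.

(** A resonant frequency is met by the trivial bound 1 + cos <= 2. *)
Let int_osc_le (z : 'rV[int]_n) (c : R) :
  (\int[m]_(y in A) (1 + cos (2 * pi * zdot z (tnth y) + c))%:E <=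
   (1 + [forall k, (L%:Z %| z 0%R k)%Z]%:R)%:E)%E.
Proof.
case: (boolP [forall k, _]) => [_|/forallPn[k kz]]; last first.
  by rewrite addr0 hosc// => /(_ k); apply/negP.
apply: (@le_trans _ _ (\int[m]_(y in A) 2%:E)%E).
  apply: ge0_le_integral => //.
  - exact: measurable_fun_torus_osc.
  - by move=> y _; rewrite lee_fin lerD2l cos_le1.
by rewrite integral_cst// mA1 mule1.
Qed.

Lemma measurable_fourier_cov (x : n.-tuple R) D :
  measurable_fun D (fun y : n.-tuple R => fourier_cov L x y).
Proof.
apply: measurable_funTS; under eq_fun do rewrite covE.
apply: measurable_sum => v; apply: measurable_funM => //.
apply: (measurableT_comp measurable_cos); apply: measurable_funM => //.
apply: (@measurable_zdot R n (val v) (fun k y => tnth x k - tnth y k)) => k.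
by apply: measurable_funB => //; exact: measurable_tnth.
Qed.

Lemma measurable_fourier_cov_pair :
  measurable_fun setT (fun p : n.-tuple R * n.-tuple R => fourier_cov L p.1 p.2).
Proof.
under eq_fun do rewrite covE.
apply: measurable_sum => v; apply: measurable_funM => //.
apply: (measurableT_comp measurable_cos); apply: measurable_funM => //.
apply: measurable_sum => k; apply: measurable_funM => //.
by apply: measurable_funB; apply: (measurableT_comp (measurable_tnth k)).
Qed.

(** Only tuples with resonant frequency sum survive integration, and these are the constrained
    tuples of the AM-GM bound. The shift to j + 2 keeps the denominator of the exponent positive. *)
Lemma integral_cov_pow_le x j : ~~ odd j ->
  (\int[m]_(y in A) (fourier_cov L x y ^+ j.+2)%:E <=
   ((\sum_(v : I) f v `^ (j.+2%:R / j.+1%:R)) ^+ j.+1)%:E)%E.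
Proof.
move=> ej; pose c (w : {ffun 'I_j.+2 -> I}) := \prod_l f (w l).
have c0 w : 0 <= c w by apply: prodr_ge0 => l _; exact: f0.
pose T := \sum_w c w.
have T0 : 0 <= T by apply: sumr_ge0 => w _; exact: c0.
have pow0 y : 0 <= fourier_cov L x y ^+ j.+2.
  by rewrite exprn_even_ge0//= negbK.
have powE y : fourier_cov L x y ^+ j.+2 + T =
    \sum_w c w * (1 + cos (2 * pi * zdot (Z w) (tnth y) + - (2 * pi * zdot (Z w) (tnth x)))).
  rewrite covE cos_sum_pow// -big_split /=; apply: eq_bigr => w _.
  rewrite zdot_sum zdotB [RHS]mulrDr mulr1 [LHS]addrC; congr (_ + _ * _).
  by rewrite -cosN; congr cos; ring.
(* Adding [T] turns the expansion into a sum of nonnegative functions. *)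
rewrite -(@leeD2rE _ T%:E)//.
have -> : (\int[m]_(y in A) (fourier_cov L x y ^+ j.+2)%:E + T%:E =
    \int[m]_(y in A) (fourier_cov L x y ^+ j.+2 + T)%:E)%E.
  under [RHS]eq_integral do rewrite EFinD.
  rewrite ge0_integralD//.
  - by rewrite integral_cst// mA1 mule1.
  - by move=> y _; rewrite lee_fin.
  - by apply/measurable_EFinP; apply: measurable_funX; exact: measurable_fourier_cov.
under eq_integral do rewrite powE -sumEFin.
rewrite ge0_integral_sum//; last 2 first.
- move=> w; under eq_fun do rewrite EFinM.
  by apply: measurable_funeM; exact: measurable_fun_torus_osc.
- by move=> w y _; rewrite lee_fin mulr_ge0// osc_ge0.
apply: (@le_trans _ _ (\sum_w (c w * (1 + (ok w)%:R))%:E)%E).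
  apply: lee_sum => w _; under eq_integral do rewrite EFinM.
  rewrite ge0_integralZl//; last 2 first.
  - exact: measurable_fun_torus_osc.
  - by rewrite lee_fin.
  by rewrite EFinM lee_wpmul2l ?lee_fin//; exact: int_osc_le.
rewrite sumEFin lee_fin.
under eq_bigr do rewrite mulrDr mulr1.
rewrite big_split /= addrC lerD2r.
rewrite (eq_bigr (fun w => if ok w then c w else 0)) => [|w _]; last by case: (ok w); rewrite ?mulr1 ?mulr0.
rewrite -big_mkcond /=; apply: constrained_prod_le => // i w w'; exact: ok_inj.
Qed.

(** The coefficients carry a_n^-(j+2) in all; j + 1 of these factors stay with the eigenvalue sum,
    where they normalise its slope, and one is left over. *)
Lemma sum_cov_coeff j :
  (\sum_(v : I) f v `^ (j.+2%:R / j.+1%:R)) ^+ j.+1 =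
  (a_const R n)^-1 * ((a_const R n)^-1 * \sum_(z \in intbox n L `\ 0)
      lambda R L z `^ (- (n%:R / 2 * (j.+2%:R / j.+1%:R)))) ^+ j.+1.
Proof.
have ai0 : 0 <= (a_const R n)^-1 by rewrite invr_ge0 ltW// a_const_gt0.
set p : R := j.+2%:R / j.+1%:R.
have -> : \sum_(v : I) f v `^ p = (a_const R n)^-1 `^ p *
    \sum_(z \in intbox n L `\ 0) lambda R L z `^ (- (n%:R / 2 * p)).
  rewrite fsbig_finite/=; last exact: finite_intbox0.
  rewrite big_seq_fsetE /= mulr_sumr; apply: eq_bigr => v _.
  by rewrite /f powRM ?powR_ge0// -powRrM mulNr.
rewrite !exprMn -powR_mulrn ?powR_ge0// -powRrM /p divfK ?pnatr_eq0//.
by rewrite powR_mulrn// [RHS]mulrA; congr (_ * _); exact: exprS.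
Qed.

End covariance_moments.

(** * Convergence of the moment series *)

Section exponential_series.
Context {R : realType}.

(** The first N terms are the sum of the partial exponential series of length 2N at u and at -u,
    whose odd terms cancel. *)
Lemma cosh_nneseries (u : R) :
  (\sum_(0 <= m <oo) (2 * (u ^+ m.*2 / m.*2`!%:R))%:E = (expR u + expR (- u))%:E)%E.
Proof.
have cvgE (x : R) : series (exp_coeff x) @ \oo --> expR x by exact: is_cvg_series_exp_coeff.
have c2 : (fun N => series (exp_coeff u) N + series (exp_coeff (- u)) N) @ \oo --> expR u + expR (- u).
  exact: (cvgD (cvgE u) (cvgE (- u))).
have dbl : (fun N => N.*2) @ \oo --> \oo.
  move=> P [N _ NP]; exists N => // k /= Nk; apply: NP => /=.
  by rewrite (leq_trans Nk)// -addnn leq_addr.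
have c3 := cvg_comp _ _ dbl c2.
apply/cvg_lim => //.
have -> : (fun N => (\sum_(0 <= m < N) (2 * (u ^+ m.*2 / m.*2`!%:R))%:E)%E) =
   (fun N => (series (exp_coeff u) N.*2 + series (exp_coeff (- u)) N.*2)%:E).
  apply/funext => N; rewrite sumEFin; congr EFin.
  elim: N => [|N IH]; first by rewrite /series /= !big_geq// addr0.
  rewrite big_nat_recr//= IH doubleS /series /= !big_nat_recr//= /exp_coeff /=.
  have even_u : (- u) ^+ N.*2 = u ^+ N.*2 by rewrite exprNn -signr_odd odd_double mul1r.
  have odd_u : (- u) ^+ N.*2.+1 = - u ^+ N.*2.+1 by rewrite exprS even_u exprS mulNr.
  rewrite even_u odd_u mulNr.
  move: (_ / _) (_ / _) (\sum_(0 <= _ < _) _) (\sum_(0 <= _ < _) _) => a b S T; ring.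
by apply: cvg_EFin; [exact: nearW|exact: c3].
Qed.

Lemma expR_le_cosh_nneseries (u : R) :
  ((expR u)%:E <= \sum_(0 <= m <oo) (2 * (u ^+ m.*2 / m.*2`!%:R))%:E)%E.
Proof. by rewrite cosh_nneseries lee_fin lerDl expR_ge0. Qed.

(** Meant for the finitely many low moments below the range of the eigenvalue estimate: a single
    higher moment controls them. *)
Lemma even_pow_le1D (u : R) m1 m2 : (m1 <= m2)%N -> u ^+ m1.*2 <= 1 + u ^+ m2.*2.
Proof.
move=> m12; have e m : 0 <= u ^+ m.*2 by rewrite exprn_even_ge0// odd_double.
have uE m : u ^+ m.*2 = `|u| ^+ m.*2 by rewrite -normrX ger0_norm.
have [u1|u1] := leP `|u| 1.
  by apply: ler_wpDr; [exact: e|rewrite uE exprn_ile1].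
by apply: ler_wpDl => //; rewrite !uE ler_weXn2l ?leq_double// ltW.
Qed.

Lemma pow_le_expR_fact m : (m%:R : R) ^+ m <= expR 1 ^+ m * m`!%:R.
Proof.
rewrite -ler_pdivrMr ?ltr0n ?fact_gt0// -expRM_natl mulr1.
by apply: pow_div_fact_le_expR.
Qed.

(** Since (1 + c / (b i))^i <= exp(c / b), the additive constant costs a bounded factor, and the
    geometric ratio depends on the slope b alone. *)
Lemma moment_term_le (t b c : R) i : (0 < i)%N -> 0 <= t -> 0 < b -> 0 <= c ->
  t ^+ i / i`!%:R * (b * i%:R + c) ^+ i <= (t * expR 1 * b) ^+ i * expR (c / b).
Proof.
move=> i0 t0 b0 c0; have iR : 0 < i%:R :> R by rewrite ltr0n.
have bi : 0 < b * i%:R by rewrite mulr_gt0.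
have -> : b * i%:R + c = (b * i%:R) * (1 + (c / b) / i%:R) by field; rewrite !gt_eqF.
have h1 : (1 + (c / b) / i%:R) ^+ i <= expR (c / b).
  rewrite -[X in expR X](@divfK _ i%:R) ?gt_eqF// expRM_natr.
  apply: lerXn2r; rewrite ?nnegrE ?expR_ge0 ?expR_ge1Dx//.
  by rewrite addr_ge0// !divr_ge0// ltW.
have h2 : (i%:R : R) ^+ i / i`!%:R <= expR 1 ^+ i.
  by rewrite ler_pdivrMr ?ltr0n ?fact_gt0// pow_le_expR_fact.
rewrite !exprMn (_ : _ * (_ * _ * _) =
  (t ^+ i * b ^+ i) * (i%:R ^+ i / i`!%:R * (1 + c / b / i%:R) ^+ i)); last by ring.
rewrite (_ : _ * _ * _ * expR _ = (t ^+ i * b ^+ i) * (expR 1 ^+ i * expR (c / b))); last by ring.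
rewrite ler_wpM2l ?mulr_ge0 ?exprn_ge0 ?(ltW b0)//.
apply: ler_pM => //.
by rewrite exprn_ge0// addr_ge0// !divr_ge0// ltW.
Qed.

Lemma nneseries_le_geometric (b : nat -> R) (Q th : R) m0 : 0 < th < 1 -> 0 <= Q ->
  (forall m, 0 <= b m) -> (forall m, (m0 <= m)%N -> b m <= Q * th ^+ m) ->
  exists B : R, (\sum_(0 <= m <oo) (b m)%:E <= B%:E)%E.
Proof.
move=> /andP[th0 th1] Q0 b0 bQ.
(* Chosen so that each of the first [m0] terms is also below [Q2] times the corresponding power of
   [th]. *)
pose Q2 := \sum_(i < m0) b i / th ^+ i.
have bi0 i : 0 <= b i / th ^+ i by rewrite divr_ge0// exprn_ge0// ltW.
have Q20 : 0 <= Q2 by apply: sumr_ge0.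
have b_le m : b m <= (Q + Q2) * th ^+ m.
  have thm : 0 < th ^+ m by rewrite exprn_gt0.
  have [mm|mm] := leqP m0 m.
    by apply: le_trans (bQ m mm) _; rewrite ler_pM2r// lerDl.
  rewrite -ler_pdivrMr// /Q2 (bigD1 (Ordinal mm))//=.
  by apply: ler_wpDl => //; rewrite lerDl; exact: sumr_ge0.
exists ((Q + Q2) / (1 - th)); apply: lime_le.
  by apply: is_cvg_nneseries => m _ _; rewrite lee_fin.
apply: nearW => N; rewrite sumEFin lee_fin.
apply: (@le_trans _ _ (\sum_(0 <= m < N) (Q + Q2) * th ^+ m)); first exact: ler_sum.
rewrite -mulr_sumr ler_wpM2l ?addr_ge0// big_mkord.
rewrite -[leRHS]mul1r ler_pdivlMr ?subr_gt0// mulrC.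
have := subrX1 th N => /eqP; rewrite -subr_eq0 => /eqP H.
have : 0 <= th ^+ N by rewrite exprn_ge0// ltW.
by move: H; set S := \sum_(i < N) _; lra.
Qed.

End exponential_series.

(** * The uniform exponential bound and the suprema over L *)

Section conclusion.
Context {R : realType}.
Variables (n : nat) (gamma : R).
Hypothesis n0 : (0 < n)%N.
Hypothesis hgamma : `|gamma| < Num.sqrt (n%:R / expR 1).

(** The order of the quantifiers is the point: [B] precedes the box, the measure, the domain and x,
    so one constant bounds both suprema. *)
Lemma exp_cov_integral_bounded : exists B : R,
  forall M (m : {measure set (n.-tuple R) -> \bar R}) (A : set (n.-tuple R)),
  measurable A -> m A = 1%E ->
  (forall (z : 'rV[int]_n) (c : R), ~ (forall k, (M.*2.+1%:Z %| z 0%R k)%Z) ->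
    \int[m]_(y in A) (1 + cos (2 * pi * zdot z (tnth y) + c))%:E = 1)%E ->
  forall x, (\int[m]_(y in A) (expR (gamma ^+ 2 * fourier_cov M.*2.+1 x y))%:E <= B%:E)%E.
Proof.
have nR : 0 < n%:R :> R by rewrite ltr0n.
have ne0 : 0 < n%:R / expR 1 :> R by rewrite divr_gt0// expR_gt0.
pose kap := gamma ^+ 2 * expR 1 / n%:R.
have kap0 : 0 <= kap by exact: divr_ge0 (mulr_ge0 (sqr_ge0 _) (expR_ge0 _)) (ltW nR).
have kap1 : kap < 1.
  rewrite ltr_pdivrMr// mul1r -ltr_pdivlMr ?expR_gt0//.
  rewrite -(sqr_sqrtr (ltW ne0)) -(real_normK (num_real gamma)).
  by rewrite ltr_pXn2r ?nnegrE// sqrtr_ge0.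
(* The gap below 1 is shared between the slope loss [r] and the geometric ratio: with these choices
   kap' - kap r = (1 - kap)^2 / 2. *)
pose kap' := (1 + kap) / 2.
have k'1 : kap' < 1 by rewrite /kap'; lra.
have k'0 : 0 < kap' by rewrite /kap'; lra.
pose r : R := 1 + (1 - kap) / 2.
have r12 : 1 < r <= 2 by rewrite /r; apply/andP; split; lra.
have r0 : 0 < r by case/andP: r12 => r1 _; exact: lt_trans r1.
have kr : kap * r <= kap'.
  rewrite /r /kap' -subr_ge0.
  rewrite (_ : _ - _ = (1 - kap) * (1 - kap) / 2 ); last by field.
  by rewrite divr_ge0// mulr_ge0// subr_ge0 ltW.
have [C [J [C0 HC]]] := @lambda_sum_le R n r n0 r12.
have a0 := @a_const_gt0 R n n0.
have ai0 : 0 <= (a_const R n)^-1 by rewrite invr_ge0 ltW.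
(* The bound on the i-th moment, with i = j + 2; hence the predecessors in place of j + 1. *)
pose V i : R := (a_const R n)^-1 * (r * (i.-1%:R / n%:R) + C) ^+ i.-1.
have V0 i : 0 <= V i.
  by rewrite mulr_ge0// exprn_ge0// addr_ge0// mulr_ge0 ?divr_ge0// ltW.
have tf0 i : 0 <= (gamma ^+ 2) ^+ i / i`!%:R.
  by exact: divr_ge0 (exprn_ge0 _ (sqr_ge0 _)) (ler0n _ _).
(* For m > J the moment 2m corresponds to j = 2 (m - 1), which is even and at least J. *)
pose m0 := J.+1.
pose b m : R := 2 * ((gamma ^+ 2) ^+ m.*2 / m.*2`!%:R *
   (if (m < m0)%N then 1 + V m0.*2 else V m.*2)).
have b0 m : 0 <= b m.
  have V1 : 0 <= 1 + V m0.*2 by rewrite addr_ge0.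
  rewrite /b; apply: mulr_ge0 => //; apply: mulr_ge0; last by case: ifP.
  exact: tf0.
have [B HB] : exists B : R, (\sum_(0 <= m <oo) (b m)%:E <= B%:E)%E.
  (* The added 1 makes the base at least 1, so that the exponent 2m - 1 may be raised to 2m. *)
  pose c := C + 1; pose bb := r / n%:R.
  have bb0 : 0 < bb by rewrite divr_gt0.
  have c0 : 0 <= c by rewrite addr_ge0.
  apply: (@nneseries_le_geometric _ b (2 * (a_const R n)^-1 * expR (c / bb)) (kap' ^+ 2) m0) => //.
  - by rewrite exprn_gt0//= exprn_ilt1// ltW.
  - by rewrite !mulr_ge0 ?expR_ge0.
  move=> m mm; rewrite /b ltnNge mm /=.
  have m2 : (0 < m.*2)%N by rewrite double_gt0; exact: leq_trans mm.
  rewrite -!mulrA ler_pM2l//.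
  have h1 : (r * (m.*2.-1%:R / n%:R) + C) ^+ m.*2.-1 <= (bb * m.*2%:R + c) ^+ m.*2.
    apply: (@le_trans _ _ ((bb * m.*2%:R + c) ^+ m.*2.-1)).
      apply: lerXn2r; rewrite ?nnegrE.
      - by rewrite addr_ge0// mulr_ge0 ?divr_ge0// ltW.
      - by rewrite addr_ge0// mulr_ge0// ltW.
      apply: lerD; last by rewrite lerDl.
      rewrite /bb mulrAC -mulrA ler_pM2l// ler_pM2r ?invr_gt0// ler_nat.
      exact: leq_pred.
    apply: ler_weXn2l; last exact: leq_pred.
    by rewrite /c addrA lerDr addr_ge0// mulr_ge0// ltW.
  apply: (@le_trans _ _ ((a_const R n)^-1 *
    ((gamma ^+ 2) ^+ m.*2 / m.*2`!%:R * (bb * m.*2%:R + c) ^+ m.*2))).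
    rewrite /V [leLHS](_ : _ = (a_const R n)^-1 * ((gamma ^+ 2) ^+ m.*2 / m.*2`!%:R *
      (r * (m.*2.-1%:R / n%:R) + C) ^+ m.*2.-1)); last by ring.
    by rewrite ler_wpM2l// ler_wpM2l.
  rewrite ler_wpM2l//; apply: le_trans (moment_term_le m2 (sqr_ge0 _) bb0 c0) _.
  rewrite mulrC ler_wpM2l ?expR_ge0// -exprM mul2n.
  apply: lerXn2r; rewrite ?nnegrE; [|exact: ltW|].
    by exact: mulr_ge0 (mulr_ge0 (sqr_ge0 _) (expR_ge0 _)) (ltW bb0).
  by apply: le_trans kr;
    rewrite le_eqVlt /bb /kap; apply/orP; left; apply/eqP; field; rewrite gt_eqF.
exists B => M m A mA mA1 hosc x.
pose k y := fourier_cov M.*2.+1 x y : R.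
have mk D : measurable_fun D k by exact: measurable_fourier_cov.
have V_le j : ~~ odd j -> (J <= j)%N -> (\int[m]_(y in A) (k y ^+ j.+2)%:E <= (V j.+2)%:E)%E.
  move=> oj Jj; apply: le_trans (integral_cov_pow_le n0 mA mA1 hosc x oj) _.
  rewrite lee_fin sum_cov_coeff// /V /= ler_wpM2l//.
  apply: lerXn2r; rewrite ?nnegrE; last exact: HC.
    rewrite mulr_ge0// fsbig_finite/=; last exact: finite_intbox0.
    by apply: sumr_ge0 => z _; exact: powR_ge0.
  by rewrite addr_ge0// mulr_ge0 ?divr_ge0// ltW.
have V_le2 l : (m0 <= l)%N -> (\int[m]_(y in A) (k y ^+ l.*2)%:E <= (V l.*2)%:E)%E.
  case: l => // l; rewrite ltnS => Jl; rewrite doubleS; apply: V_le; first by rewrite odd_double.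
  by rewrite (leq_trans Jl)// -addnn leq_addr.
have kpow0 l y : 0 <= k y ^+ l.*2 by rewrite exprn_even_ge0// odd_double.
have mkpow l D : measurable_fun D (fun y => (k y ^+ l.*2)%:E).
  by apply/measurable_EFinP; apply: measurable_funX.
have g2 : 0 <= gamma ^+ 2 by exact: sqr_ge0.
have term0 l y : (0 <= (2 * ((gamma ^+ 2 * k y) ^+ l.*2 / l.*2`!%:R))%:E)%E.
  by rewrite lee_fin mulr_ge0// divr_ge0// exprn_even_ge0// odd_double.
have mterm l D : measurable_fun D (fun y => (2 * ((gamma ^+ 2 * k y) ^+ l.*2 / l.*2`!%:R))%:E).
  apply/measurable_EFinP; apply: measurable_funM => //; apply: measurable_funM => //.
  by apply: measurable_funX; apply: measurable_funM.
apply: (@le_trans _ _ (\int[m]_(y in A) (\sum_(0 <= l <oo)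
   (2 * ((gamma ^+ 2 * k y) ^+ l.*2 / l.*2`!%:R))%:E))%E).
  apply: ge0_le_integral => //.
  - apply/measurable_EFinP; apply: measurableT_comp => //.
    exact: measurable_funM.
  - by apply: (@ge0_emeasurable_sum _ _ _ _ _ xpredT) => [l y _ _|l _]; [exact: term0|exact: mterm].
  - by move=> y _; exact: expR_le_cosh_nneseries.
rewrite integral_nneseries//.
apply: le_trans HB; apply: lee_nneseries => [l _ _|l _]; first exact: integral_ge0.
have -> : (\int[m]_(y in A) (2 * ((gamma ^+ 2 * k y) ^+ l.*2 / l.*2`!%:R))%:E =
   (2 * ((gamma ^+ 2) ^+ l.*2 / l.*2`!%:R))%:E * \int[m]_(y in A) (k y ^+ l.*2)%:E)%E.
  rewrite -ge0_integralZl//.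
  - apply: eq_integral => y _; rewrite -EFinM; congr EFin; rewrite exprMn; ring.
  - by move=> y _; rewrite lee_fin.
  - by rewrite lee_fin mulr_ge0.
rewrite /b [X in (_ <= X%:E)%E]mulrA [leRHS]EFinM; apply: lee_wpmul2l; first by rewrite lee_fin mulr_ge0.
case: ltnP => lm; last exact: V_le2.
apply: (@le_trans _ _ (\int[m]_(y in A) (1%:E + (k y ^+ m0.*2)%:E))%E).
  apply: ge0_le_integral => //.
  - by move=> y _; rewrite lee_fin.
  - exact: emeasurable_funD.
  - by move=> y _; rewrite -EFinD lee_fin even_pow_le1D// ltnW.
rewrite ge0_integralD//; last by move=> y _; rewrite lee_fin.
by rewrite integral_cst// mA1 mule1 EFinD leeD2l//; exact: V_le2.
Qed.

End conclusion.

Theorem theorem0p7 (R : realType) (n : nat) (hn : (1 <= n)%N) (gamma : R)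
    (hgamma : `|gamma| < Num.sqrt (n%:R / expR 1))
    (Zhat : set 'rV[int]_n) (hZhat : half_lattice Zhat)
    (d : measure_display) (Omega : measurableType d) (P : probability Omega R)
    (xi : 'rV[int]_n -> {RV P >-> R})
    (hxi : iid_standard_normal P (~` [set 0]) xi) :
  (ereal_sup [set (\int[P]_w
      `|lqg_discrete Zhat gamma L (fun z => xi z w) (torus_grid R n L)| ^+ 2)%E
    | L in [set L : nat | odd L]] < +oo)%E /\
  (ereal_sup [set (\int[P]_w
      `|lqg_semidiscrete Zhat gamma L (fun z => xi z w) (torus R n)| ^+ 2)%E
    | L in [set L : nat | odd L]] < +oo)%E.
Proof.
have [B HB] := exp_cov_integral_bounded hn hgamma.
have bound M (m : {sigma_finite_measure set (n.-tuple R) -> \bar R}) (A : set (n.-tuple R)) :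
    measurable A -> m A = 1%E ->
    (forall (z : 'rV[int]_n) (c : R), ~ (forall k, (M.*2.+1%:Z %| z 0%R k)%Z) ->
      \int[m]_(y in A) (1 + cos (2 * pi * zdot z (tnth y) + c))%:E = 1)%E ->
    (\int[P]_w `|lqg m gamma (fourier_field Zhat M.*2.+1 (fun z => xi z w))
       (fourier_cov M.*2.+1) A| ^+ 2 <= B%:E)%E.
  move=> mA mA1 hosc.
  rewrite (second_moment_lqg hZhat (a_const_gt0 hn) hxi gamma _ _ mA).
  apply: (@le_trans _ _ (\int[m]_(x in A) B%:E)%E).
    apply: ge0_le_integral => //.
    - by move=> x _; apply: integral_ge0 => y _; rewrite lee_fin expR_ge0.
    - apply: measurable_funTS.
      (* Writing the domain of y as an indicator makes the inner integral a partial integral of a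
         jointly measurable function, hence measurable in x. *)
      pose F (p : n.-tuple R * n.-tuple R) : \bar R :=
        ((expR (gamma ^+ 2 * fourier_cov M.*2.+1 p.1 p.2))%:E * (\1_A p.2)%:E)%E.
      rewrite (_ : (fun _ => _) = fun x => (\int[m]_y F (x, y))%E); last first.
        apply/funext => x; rewrite integral_mkcond; apply: eq_integral => y _.
        by rewrite /patch /F indicE; case: ifP; rewrite ?mule1 ?mule0.
      apply: measurable_fun_fubini_tonelli_F.
        apply: emeasurable_funM; apply/measurable_EFinP.
          apply: measurableT_comp => //; apply: measurable_funM => //.
          exact: measurable_fourier_cov_pair.
        by apply: (@measurableT_comp _ _ _ _ _ _ (\1_A : _ -> R));
    [exact: measurable_indic|exact: measurable_snd].
      by move=> p; rewrite mule_ge0// lee_fin ?expR_ge0.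
    - by move=> x _; exact: HB.
  by rewrite integral_cst// [X in (_ * X)%E]mA1 mule1.
have oddE L : odd L -> L = L./2.*2.+1 by move=> oL; rewrite -[LHS]odd_double_half oL.
split; apply: (@le_lt_trans _ _ B%:E) (ltry _); apply: ge_ereal_sup => _ [L oL <-].
- rewrite /lqg_discrete (oddE _ oL); apply: bound.
  + exact: measurable_torus_grid.
  + exact: grid_measure_torus_grid.
  + move=> z c; exact: integral_grid_osc.
- rewrite /lqg_semidiscrete (oddE _ oL); apply: bound.
  + exact: measurable_torus.
  + exact: lebesgue_tuple_torus.
  (* The zero frequency, the only one whose torus integral can differ from 1, is divisible by L and
     so excluded by [Lz]. *)
  + move=> z c Lz; rewrite integral_torus_osc; case: eqP => // z0.
    by case: Lz => k; rewrite z0 mxE dvdz0.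
Qed.
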